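(* Let $\Bbbk$ be an algebraically closed field of characteristic $p>2$, let $V$ be the braided vector space with basis $\{x,y\}$ defined in the context, and let $\widetilde{\mathscr B}=T(V)/(yx-xy+\frac12x^2)$ be the Jordan plane. If $\mathscr R$ is a finite-dimensional pre-Nichols algebra of $V$ that factorizes through $\widetilde{\mathscr B}$ (i.e. there is a morphism of pre-Nichols algebras $\widetilde{\mathscr B}\twoheadrightarrow\mathscr R$), then $\mathscr R\simeq\mathcal G(k,\ell)$ as braided Hopf algebras for unique $k,\ell\in\mathbb N$, where $$\mathcal G(k,\ell)=\widetilde{\mathscr B}/(y^{p^k},x^{p^\ell}).$$
   Context: $\mathbb N=\{1,2,\dots\}$. Let $\Gamma=\langle g\rangle\simeq\mathbb Z/p\mathbb Z$. $V$ is the Yetter-Drinfeld module over $\Bbbk\Gamma$ with basis $\{x,y\}$, action $g\rightharpoonup x=x$, $g\rightharpoonup y=y+x$, and coaction $\delta(x)=g\otimes x$, $\delta(y)=g\otimes y$. Its braiding is $c(x\otimes x)=x\otimes x$, $c(x\otimes y)=(y+x)\otimes x$, $c(y\otimes x)=x\otimes y$, $c(y\otimes y)=(y+x)\otimes y$. $T(V)$ is the graded braided Hopf algebra with $V$ primitive, and $\widetilde{\mathscr B}$ and $\mathcal G(k,\ell)$ are quotient graded braided Hopf algebras of it. A pre-Nichols algebra of a braided vector space $\mathcal V$ is a graded connected braided Hopf algebra $\mathscr R=\oplus_{n\ge0}\mathscr R^n$ with $\mathscr R^1\simeq\mathcal V$ as braided vector spaces and such that $\mathscr R^1$ generates $\mathscr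 R$ as an algebra. A morphism of pre-Nichols algebras is a morphism of graded connected braided Hopf algebras inducing the identity on $\mathcal V$. *)

(* Defs.v *)
From HB Require Import structures.
From mathcomp Require Import all_boot all_order all_algebra all_field.
From mathcomp Require Import generic_quotient ring_quotient.
From mathcomp Require Import boolp.
From mathcomp Require Import finmap.
From mathcomp.multinomials Require Import monalg.

Set Implicit Arguments.
Unset Strict Implicit.
Unset Printing Implicit Defensive.

Import GRing.Theory.

Local Open Scope ring_scope.
Local Open Scope quotient_scope.

Inductive span (K : fieldType) (M : lmodType K) (S : M -> Prop) : M -> Prop :=
| span_mem u : S u -> span S u
| span0 : span S 0
| spanD u v : span S u -> span S v -> span S (u + v)
| spanZ a u : span S u -> span S (a *: u).

Inductive subalg (K : fieldType) (A : algType K) (S : A -> Prop) : A -> Prop :=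
| subalg_mem u : S u -> subalg S u
| subalg1 : subalg S 1
| subalgD u v : subalg S u -> subalg S v -> subalg S (u + v)
| subalgZ a u : subalg S u -> subalg S (a *: u)
| subalgM u v : subalg S u -> subalg S v -> subalg S (u * v).

Definition subspace (K : fieldType) (M : lmodType K) (P : M -> Prop) : Prop :=
  P 0 /\ forall (a : K) u v, P u -> P v -> P (a *: u + v).

Section LinearQuotient.
Variables (K : fieldType) (M : lmodType K) (S : M -> Prop).

Definition spanp (u : M) : bool := `[< span S u >].

Lemma spanp_zmod_closed : zmod_closed spanp.
Proof.
split=> [|u v /asboolP Su /asboolP Sv]; apply/asboolP; first exact: span0.
by apply: spanD => //; rewrite -scaleN1r; apply: spanZ.
Qed.
HB.instance Definition _ := GRing.isZmodClosed.Build M spanp spanp_zmod_closed.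

Definition lquot : Type := {ideal_quot (GRing.ZmodClosed.clone M spanp _)}.
HB.instance Definition _ := GRing.Zmodule.on lquot.
HB.instance Definition _ := EqQuotient.on lquot.

Definition lpi (u : M) : lquot := \pi u.

Lemma lpiE u v : lpi u = lpi v <-> span S (u - v).
Proof.
split=> [/eqP|uv]; last apply/eqP; rewrite /lpi -[_ == _]Quotient.idealrBE.
  by move/asboolP.
exact/asboolP.
Qed.

Lemma lreprK q : lpi (repr q) = q.
Proof. exact: reprK. Qed.

Lemma lpiD u v : lpi (u + v) = lpi u + lpi v.
Proof. by rewrite /lpi !piE. Qed.

Lemma lpi0 : lpi 0 = 0.
Proof. by rewrite /lpi !piE. Qed.

Definition lquot_scale (a : K) (q : lquot) : lquot := lpi (a *: repr q).

Lemma lpiZ a u : lpi (a *: u) = lquot_scale a (lpi u).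
Proof.
apply/lpiE; rewrite -scalerBr; apply: spanZ; apply/lpiE.
by rewrite lreprK.
Qed.

Fact lquot_scalerA a b q :
  lquot_scale a (lquot_scale b q) = lquot_scale (a * b) q.
Proof. by rewrite -[q]lreprK -!lpiZ scalerA. Qed.
Fact lquot_scale1r : left_id 1 lquot_scale.
Proof. by move=> q; rewrite -[q]lreprK -!lpiZ scale1r. Qed.
Fact lquot_scalerDr : right_distributive lquot_scale +%R.
Proof.
by move=> a q r; rewrite -[q]lreprK -[r]lreprK -!(lpiD, lpiZ) scalerDr.
Qed.
Fact lquot_scalerDl q : {morph lquot_scale^~ q : a b / a + b}.
Proof. by move=> a b; rewrite -[q]lreprK -!(lpiD, lpiZ) scalerDl. Qed.
HB.instance Definition _ := GRing.Zmodule_isLmodule.Build K lquot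
  lquot_scalerA lquot_scale1r lquot_scalerDr lquot_scalerDl.

Fact lpi_is_linear : linear lpi.
Proof. by move=> a u v; rewrite lpiD lpiZ. Qed.
HB.instance Definition _ :=
  GRing.isLinear.Build K M lquot *:%R lpi lpi_is_linear.

End LinearQuotient.

Section AlgebraQuotient.
Variables (K : fieldType) (A : algType K) (S : A -> Prop).

(* The two-sided ideal generated by S is the span of [ideal_gens]. *)
Definition ideal_gens (u : A) : Prop := exists a b s, S s /\ u = a * s * b.

Definition ideal : A -> Prop := span ideal_gens.

Lemma idealMl a u : ideal u -> ideal (a * u).
Proof.
elim=> [_ [b [c [s [Ss ->]]]]||v w _ IHv _ IHw|c v _ IHv].
- by apply: span_mem; exists (a * b), c, s; rewrite !mulrA.
- by rewrite mulr0; apply: span0.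
- by rewrite mulrDr; apply: spanD.
- by rewrite -scalerAr; apply: spanZ.
Qed.

Lemma idealMr a u : ideal u -> ideal (u * a).
Proof.
elim=> [_ [b [c [s [Ss ->]]]]||v w _ IHv _ IHw|c v _ IHv].
- by apply: span_mem; exists b, (c * a), s; rewrite !mulrA.
- by rewrite mul0r; apply: span0.
- by rewrite mulrDl; apply: spanD.
- by rewrite -scalerAl; apply: spanZ.
Qed.

Lemma ideal_mem s : S s -> ideal s.
Proof. by move=> Ss; apply: span_mem; exists 1, 1, s; rewrite mul1r mulr1. Qed.

Section Proper.
Variable e : A -> K.
Hypothesis e_linear : linear (e : A -> K^o).
Hypothesis eM : forall a b, e (a * b) = e a * e b.
Hypothesis eS : forall s, S s -> e s = 0.

Lemma ideal_kills u : ideal u -> e u = 0.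
Proof.
have e0 : e 0 = 0.
  by have := e_linear (-1) 0 0; rewrite scaler0 addr0 scaleN1r addNr.
elim=> [_ [a [b [s [/eS es ->]]]]||v w _ ev _ ew|a v _ ev] //.
- by rewrite !eM es mulr0 mul0r.
- by have := e_linear 1 v w; rewrite !scale1r ev ew addr0.
- by have := e_linear a v 0; rewrite addr0 ev e0 scaler0 addr0.
Qed.

Lemma ideal_proper : e 1 = 1 -> ~ ideal 1.
Proof. by move=> e1 /ideal_kills; rewrite e1 => /eqP; rewrite oner_eq0. Qed.

End Proper.

Hypothesis S_proper : ~ ideal 1.

(* The algebra A / (S); properness of (S) is needed because algebras are      *)
(* nonzero in MathComp.                                                       *)
Definition aquot of ~ ideal 1 : Type := lquot ideal_gens.
Local Notation Q := (aquot S_proper).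
HB.instance Definition _ := GRing.Lmodule.on Q.

Definition api (a : A) : Q := lpi ideal_gens a.
Fact api_is_linear : linear api.
Proof. exact: lpi_is_linear. Qed.
HB.instance Definition _ := GRing.isLinear.Build K A Q *:%R api api_is_linear.

Definition arepr (q : Q) : A := repr (q : lquot ideal_gens).

Lemma apiE a b : api a = api b <-> ideal (a - b).
Proof. exact: lpiE. Qed.

Lemma areprK q : api (arepr q) = q.
Proof. exact: lreprK. Qed.

Definition aquot_one : Q := api 1.
Definition aquot_mul (q r : Q) : Q := api (arepr q * arepr r).

Lemma apiM_ a b : api (a * b) = aquot_mul (api a) (api b).
Proof.
apply/apiE; set a' := arepr _; set b' := arepr _.
have -> : a * b - a' * b' = (a - a') * b + a' * (b - b').
  by rewrite mulrBl mulrBr addrA subrK.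
by apply: spanD; [apply: idealMr | apply: idealMl]; apply/apiE; rewrite areprK.
Qed.

Fact aquot_mulA : associative aquot_mul.
Proof.
move=> q r s; rewrite -[q]areprK -[r]areprK -[s]areprK.
by rewrite -!apiM_ mulrA.
Qed.
Fact aquot_mul1 : left_id aquot_one aquot_mul.
Proof. by move=> q; rewrite -[q]areprK -!apiM_ mul1r. Qed.
Fact aquot_mulr1 : right_id aquot_one aquot_mul.
Proof. by move=> q; rewrite -[q]areprK -!apiM_ mulr1. Qed.
Fact aquot_mulDl : left_distributive aquot_mul +%R.
Proof.
move=> q r s; rewrite -[q]areprK -[r]areprK -[s]areprK.
by rewrite -!(raddfD, apiM_) mulrDl.
Qed.
Fact aquot_mulDr : right_distributive aquot_mul +%R.
Proof.
move=> q r s; rewrite -[q]areprK -[r]areprK -[s]areprK.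
by rewrite -!(raddfD, apiM_) mulrDr.
Qed.
Fact aquot_one_neq0 : aquot_one != 0.
Proof.
apply/eqP; rewrite /aquot_one -(raddf0 api) => /apiE; rewrite subr0.
exact: S_proper.
Qed.
HB.instance Definition _ := GRing.Zmodule_isNzRing.Build Q
  aquot_mulA aquot_mul1 aquot_mulr1 aquot_mulDl aquot_mulDr aquot_one_neq0.

Fact aquot_scalerAl (a : K) (q r : Q) : a *: (q * r) = (a *: q) * r.
Proof.
rewrite -[q]areprK -[r]areprK; move: (arepr q) (arepr r) => u v.
transitivity (api (a *: (u * v))); first by rewrite linearZ /= apiM_.
by rewrite scalerAl apiM_ linearZ.
Qed.
Fact aquot_scalerAr (a : K) (q r : Q) : a *: (q * r) = q * (a *: r).
Proof.
rewrite -[q]areprK -[r]areprK; move: (arepr q) (arepr r) => u v.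
transitivity (api (a *: (u * v))); first by rewrite linearZ /= apiM_.
by rewrite scalerAr apiM_ linearZ.
Qed.
HB.instance Definition _ := GRing.Lmodule_isLalgebra.Build K Q aquot_scalerAl.
HB.instance Definition _ := GRing.Lalgebra_isAlgebra.Build K Q aquot_scalerAr.

Fact api_is_monoid_morphism : monoid_morphism api.
Proof. by split=> // a b; apply: apiM_. Qed.
HB.instance Definition _ :=
  GRing.isMonoidMorphism.Build A Q api api_is_monoid_morphism.

End AlgebraQuotient.

Section FreeLift.
Local Open Scope fset_scope.
Variables (K : fieldType) (I : choiceType) (W : lmodType K) (h : I -> W).

Definition flift (z : {malg K[I]}) : W := \sum_(i <- msupp z) z@_i *: h i.

Lemma fliftEw (d : {fset I}) z : msupp z `<=` d ->
  flift z = \sum_(i <- d) z@_i *: h i.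
Proof.
move=> le; rewrite /flift; apply: big_fset_incl => // i _ /mcoeff_outdom ->.
by rewrite scale0r.
Qed.

Fact flift_is_linear : linear flift.
Proof.
move=> a z t; pose d := msupp z `|` msupp t.
have le_d : msupp (a *: z + t) `<=` d.
  apply: (fsubset_trans (msuppD_le _ _)); apply: fsetSU.
  exact: msuppZ_le.
rewrite (fliftEw le_d) (fliftEw (fsubsetUl _ _ : _ `<=` d)).
rewrite (fliftEw (fsubsetUr _ _ : _ `<=` d)) scaler_sumr -big_split /=.
apply: eq_bigr => i _.
by rewrite mcoeffD mcoeffZ scalerDl scalerA.
Qed.
HB.instance Definition _ :=
  GRing.isLinear.Build K {malg K[I]} W *:%R flift flift_is_linear.

Lemma fliftU i : flift << i >> = h i.
Proof. by rewrite /flift msuppU oner_eq0 big_seq_fset1 mcoeffUU scale1r. Qed.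

End FreeLift.

Definition bilin (K : fieldType) (U V W : lmodType K) (f : U -> V -> W) : Prop :=
  (forall u, linear (f u)) /\ (forall v, linear (f^~ v)).

Section Tensor.
Variables (K : fieldType) (U V : lmodType K).
Implicit Types (u : U) (v : V).

Inductive tensor_rel : {malg K[(U * V)%type]} -> Prop :=
| tensor_rel_l a u u' v :
    tensor_rel (<< (a *: u + u', v) >> - (a *: << (u, v) >> + << (u', v) >>))
| tensor_rel_r a u v v' :
    tensor_rel (<< (u, a *: v + v') >> - (a *: << (u, v) >> + << (u, v') >>)).

Definition tensor : Type := lquot tensor_rel.
HB.instance Definition _ := GRing.Lmodule.on tensor.

End Tensor.
Arguments tensor {K} U%_type V%_type.

HB.lock Definition tens (K : fieldType) (U V : lmodType K) (u : U) (v : V) :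
  tensor U V := lpi (@tensor_rel K U V) << (u, v) >>.

(* The linear map on the tensor product induced by f.  The definition makes   *)
(* sense for every f (through a choice of representatives), but is only       *)
(* meaningful when f is bilinear; see [tlift_tens] and [tlift_linear].        *)
HB.lock Definition tlift (K : fieldType) (U V W : lmodType K)
    (f : U -> V -> W) (t : tensor U V) : W :=
  flift (fun uv => f uv.1 uv.2) (repr (t : lquot (@tensor_rel K U V))).

Section TensorTheory.
Variables (K : fieldType) (U V : lmodType K).
Local Notation tens := (@tens K U V).
Local Notation tensor_rel := (@tensor_rel K U V).

Lemma tens_bilin : bilin tens.
Proof.
split=> [u a v v'|v a u u'] /=; rewrite tens.unlock -linearP; apply/lpiE.
  by apply: span_mem; apply: tensor_rel_r.
by apply: span_mem; apply: tensor_rel_l.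
Qed.

Section TLiftTheory.
Variables (W : lmodType K) (f : U -> V -> W).
Hypothesis f_bilin : bilin f.

Lemma tlift_lpi z :
  tlift f (lpi tensor_rel z) = flift (fun uv => f uv.1 uv.2) z.
Proof.
apply/eqP; rewrite tlift.unlock -subr_eq0 -linearB /=; apply/eqP.
have : span tensor_rel (repr (lpi tensor_rel z) - z).
  by apply/lpiE; rewrite lreprK.
elim=> [_ [a u u' v|a u v v']||s t _ IHs _ IHt|a s _ IHs].
- by rewrite linearB linearP /= !fliftU /= (f_bilin.2 v a u u') subrr.
- by rewrite linearB linearP /= !fliftU /= (f_bilin.1 u a v v') subrr.
- by rewrite linear0.
- by rewrite linearD /= IHs IHt addr0.
- by rewrite linearZ /= IHs scaler0.
Qed.

Lemma tlift_tens u v : tlift f (tens u v) = f u v.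
Proof. by rewrite tens.unlock tlift_lpi fliftU. Qed.

Lemma tlift_linear : linear (tlift f).
Proof.
move=> a s t; rewrite -[s]lreprK -[t]lreprK -linearP.
by rewrite !tlift_lpi linearP.
Qed.

End TLiftTheory.

Lemma tensZl a u v : tens (a *: u) v = a *: tens u v.
Proof.
have e0 : tens 0 v = 0.
  have := tens_bilin.2 v (-1) 0 0.
  by rewrite /= scaler0 add0r scaleN1r addNr.
by have := tens_bilin.2 v a u 0; rewrite /= !addr0 e0 addr0.
Qed.

Lemma tensor_ind (P : tensor U V -> Prop) :
  (forall u v, P (tens u v)) -> P 0 -> (forall s t, P s -> P t -> P (s + t)) ->
  forall t, P t.
Proof.
move=> P1 P0 PD t; rewrite -[t]lreprK; set z := repr _.
rewrite (monalgE z) linear_sum /=; elim/big_ind: _ => // -[u v] _.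
have -> : << z@_(u, v) *g (u, v) >> = z@_(u, v) *: << (u, v) >>.
  by apply/malgP=> k; rewrite mcoeffZ !mcoeffU mulrnAr mulr1.
rewrite linearZ /= (_ : _ *: _ = tens (z@_(u, v) *: u) v); first exact: P1.
by rewrite tensZl tens.unlock.
Qed.

End TensorTheory.

Notation "U ⊗ V" := (tensor U V)
  (at level 40, left associativity) : type_scope.
Notation "u ⊗ v" := (tens u v)
  (at level 40, left associativity) : ring_scope.

Section TensorMaps.
Variable K : fieldType.

Definition tmap (U V U' V' : lmodType K) (f : U -> U') (g : V -> V') :
  U ⊗ V -> U' ⊗ V' := tlift (fun u v => f u ⊗ g v).

Definition tassoc (U V W : lmodType K) : U ⊗ V ⊗ W -> U ⊗ (V ⊗ W) :=
  tlift (fun t w => tlift (fun u v => u ⊗ (v ⊗ w)) t).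

Definition tassocV (U V W : lmodType K) : U ⊗ (V ⊗ W) -> U ⊗ V ⊗ W :=
  tlift (fun u t => tlift (fun v w => u ⊗ v ⊗ w) t).

Definition tmul (A : algType K) : A ⊗ A -> A := tlift *%R.

End TensorMaps.

Section Braided.
Variable K : fieldType.

(* [braid1] and [braid2] are c ⊗ id and id ⊗ c on U ⊗ U ⊗ U. *)
Definition braid1 (U : lmodType K) (c : U ⊗ U -> U ⊗ U) :
  U ⊗ U ⊗ U -> U ⊗ U ⊗ U := tmap c id.
Definition braid2 (U : lmodType K) (c : U ⊗ U -> U ⊗ U) :
  U ⊗ U ⊗ U -> U ⊗ U ⊗ U := fun t => tassocV (tmap id c (tassoc t)).

Record is_braiding (U : lmodType K) (c : U ⊗ U -> U ⊗ U) : Prop := {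
  braid_linear : linear c;
  braid_bij : bijective c;
  braid_eq : forall t,
    braid1 c (braid2 c (braid1 c t)) = braid2 c (braid1 c (braid2 c t))
}.

Record braidedHopf (A : algType K) := BraidedHopf {
  braid : A ⊗ A -> A ⊗ A;
  comul : A -> A ⊗ A;
  counit : A -> K
}.

(* The product of the braided tensor square of A:                             *)
(* (a ⊗ b)(d ⊗ e) = (a ⊗ 1) c(b ⊗ d) (1 ⊗ e).                                 *)
Definition bmul (A : algType K) (c : A ⊗ A -> A ⊗ A) (s t : A ⊗ A) : A ⊗ A :=
  tlift (fun a b => tlift (fun d e =>
    tlift (fun d' b' => (a * d') ⊗ (b' * e)) (c (b ⊗ d))) t) s.

(* Braided Hopf algebras in the sense of Takeuchi: all the structure maps     *)
(* commute with the braiding.  The antipode, being unique, is only required   *)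
(* to exist.                                                                  *)
Record is_braided_hopf (A : algType K) (H : braidedHopf A) : Prop := {
  bh_braiding : is_braiding (braid H);
  bh_comul_linear : linear (comul H);
  bh_counit_linear : linear (counit H : A -> K^o);
  bh_coassoc : forall a,
    tassoc (tmap (comul H) id (comul H a)) = tmap id (comul H) (comul H a);
  bh_counitl : forall a, tlift (fun u v => counit H u *: v) (comul H a) = a;
  bh_counitr : forall a, tlift (fun u v => counit H v *: u) (comul H a) = a;
  bh_braid1l : forall a, braid H (1 ⊗ a) = a ⊗ 1;
  bh_braid1r : forall a, braid H (a ⊗ 1) = 1 ⊗ a;
  bh_braidMl : forall t : A ⊗ A ⊗ A,
    braid H (tmap (@tmul K A) id t) =
    tmap id (@tmul K A) (tassoc (braid1 (braid H) (braid2 (braid H) t)));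
  bh_braidMr : forall t : A ⊗ A ⊗ A,
    braid H (tmap id (@tmul K A) (tassoc t)) =
    tmap (@tmul K A) id (braid2 (braid H) (braid1 (braid H) t));
  bh_braid_counitl : forall a b,
    tlift (fun u v => counit H u *: v) (braid H (a ⊗ b)) = counit H b *: a;
  bh_braid_counitr : forall a b,
    tlift (fun u v => counit H v *: u) (braid H (a ⊗ b)) = counit H a *: b;
  bh_braid_comull : forall t,
    tassocV (tmap id (comul H) (braid H t)) =
    braid1 (braid H) (braid2 (braid H) (tmap (comul H) id t));
  bh_braid_comulr : forall t,
    tmap (comul H) id (braid H t) =
    braid2 (braid H) (braid1 (braid H) (tassocV (tmap id (comul H) t)));
  bh_counit1 : counit H 1 = 1;
  bh_counitM : forall a b, counit H (a * b) = counit H a * counit H b;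
  bh_comul1 : comul H 1 = 1 ⊗ 1;
  bh_comulM : forall a b,
    comul H (a * b) = bmul (braid H) (comul H a) (comul H b);
  bh_antipode : exists2 s : A -> A, linear s & forall a,
    tlift (fun u v => s u * v) (comul H a) = counit H a *: 1 /\
    tlift (fun u v => u * s v) (comul H a) = counit H a *: 1
}.

Definition is_braided_hopf_morphism (A B : algType K)
    (HA : braidedHopf A) (HB : braidedHopf B) (f : A -> B) : Prop :=
  [/\ forall a, comul HB (f a) = tmap f f (comul HA a),
      forall a, counit HB (f a) = counit HA a
    & forall t, braid HB (tmap f f t) = tmap f f (braid HA t)].

Definition braided_hopf_iso (A B : algType K)
    (HA : braidedHopf A) (HB : braidedHopf B) : Prop :=
  exists2 f : {lrmorphism A -> B},
    is_braided_hopf_morphism HA HB f & bijective f.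

(* [gr n a] says that a is homogeneous of degree n. *)
Record is_graded_connected (A : algType K) (H : braidedHopf A)
    (gr : nat -> A -> Prop) : Prop := {
  gr_subspace : forall n, subspace (gr n);
  gr_exists : forall a, exists n (f : nat -> A),
    (forall i, gr i (f i)) /\ a = \sum_(i < n) f i;
  gr_direct : forall n (f : nat -> A), (forall i, gr i (f i)) ->
    \sum_(i < n) f i = 0 -> forall i, (i < n)%N -> f i = 0;
  gr_one : gr 0 1;
  gr_mul : forall i j a b, gr i a -> gr j b -> gr (i + j) (a * b);
  gr_counit : forall n a, gr n.+1 a -> counit H a = 0;
  gr_comul : forall n a, gr n a ->
    span (fun t => exists i j u v,
      [/\ (i + j)%N = n, gr i u, gr j v & t = u ⊗ v]) (comul H a);
  gr_braid : forall i j a b, gr i a -> gr j b ->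
    span (fun t => exists u v, [/\ gr j u, gr i v & t = u ⊗ v])
      (braid H (a ⊗ b));
  gr_connected : forall a, gr 0 a -> exists c, a = c *: 1
}.

(* [pn_inj] is the identification of V with the component of degree 1. *)
Record preNichols (V : lmodType K) (A : algType K) := PreNichols {
  pn_hopf :> braidedHopf A;
  pn_gr : nat -> A -> Prop;
  pn_inj : V -> A
}.

Record is_pre_nichols (V : lmodType K) (cV : V ⊗ V -> V ⊗ V)
    (A : algType K) (R : preNichols V A) : Prop := {
  pn_braided_hopf : is_braided_hopf R;
  pn_graded : is_graded_connected R (pn_gr R);
  pn_inj_linear : linear (pn_inj R);
  pn_inj_injective : injective (pn_inj R);
  pn_inj_image : forall a, pn_gr R 1 a <-> exists v, a = pn_inj R v;
  pn_inj_braid : forall t,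
    braid R (tmap (pn_inj R) (pn_inj R) t) =
    tmap (pn_inj R) (pn_inj R) (cV t);
  pn_generated : forall a, subalg (pn_gr R 1) a
}.

Definition is_pre_nichols_morphism (V : lmodType K) (A B : algType K)
    (RA : preNichols V A) (RB : preNichols V B) (f : A -> B) : Prop :=
  [/\ is_braided_hopf_morphism RA RB f,
      forall n a, pn_gr RA n a -> pn_gr RB n (f a)
    & forall v, f (pn_inj RA v) = pn_inj RB v].

(* The structure on A / (S) induced by that of A.  When (S) is a homogeneous  *)
(* braided Hopf ideal it does not depend on the representatives, and the      *)
(* projection is a morphism.                                                  *)
Definition quot_pn (V : lmodType K) (A : algType K) (R : preNichols V A)
    (S : A -> Prop) (S_proper : ~ ideal S 1) :
  preNichols V (aquot S_proper) :=
  let pi := api S_proper in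
  {| pn_hopf :=
       {| braid := tlift (fun q r =>
            tmap pi pi (braid R (arepr q ⊗ arepr r)));
          comul := fun q => tmap pi pi (comul R (arepr q));
          counit := fun q => counit R (arepr q) |};
     pn_gr := fun n q => exists2 a, pn_gr R n a & q = pi a;
     pn_inj := fun v => pi (pn_inj R v) |}.

End Braided.

Section FreeAlgebra.
Variables (K : fieldType) (M : monomType).

Fact malg_scalerAr (a : K) (u v : {malg K[M]}) : a *: (u * v) = u * (a *: v).
Proof.
apply/malgP=> k; rewrite mcoeffZ mcoeffMl.
rewrite (mcoeffMlw k (fsubset_refl _) (msuppZ_le a v)) mulr_sumr.
apply: eq_bigr => i _; rewrite mulr_sumr; apply: eq_bigr => j _.
by rewrite mcoeffZ mulrnAr mulrCA.
Qed.

End FreeAlgebra.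

Section TensorAlgebra.
Variable K : fieldType.

Definition Vsp : lmodType K := 'rV[K]_2.
Definition xV : Vsp := delta_mx ord0 ord0.
Definition yV : Vsp := delta_mx ord0 ord_max.

(* The action of g: x |-> x, y |-> y + x. *)
Definition gV (v : Vsp) : Vsp := v + (v : 'rV[K]_2) ord0 ord_max *: xV.

(* As V has coaction v |-> g ⊗ v, its braiding is v ⊗ w |-> g w ⊗ v. *)
Definition cV : Vsp ⊗ Vsp -> Vsp ⊗ Vsp := tlift (fun v w => gV w ⊗ v).

Lemma gV_x : gV xV = xV.
Proof. by rewrite /gV !mxE /= scale0r addr0. Qed.

Lemma gV_y : gV yV = yV + xV.
Proof. by rewrite /gV !mxE /= scale1r. Qed.

Lemma cV_tens v w : cV (v ⊗ w) = gV w ⊗ v.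
Proof.
have [tl tr] := tens_bilin Vsp Vsp.
apply: tlift_tens; split=> [u a u1 u2|u]; last exact: tl.
suff -> : gV (a *: u1 + u2) = a *: gV u1 + gV u2 by exact: tr.
by rewrite /gV !mxE scalerDr scalerDl scalerA addrACA.
Qed.

Lemma cV_basis :
  [/\ cV (xV ⊗ xV) = xV ⊗ xV, cV (xV ⊗ yV) = (yV + xV) ⊗ xV,
      cV (yV ⊗ xV) = xV ⊗ yV & cV (yV ⊗ yV) = (yV + xV) ⊗ yV].
Proof. by rewrite !cV_tens gV_x gV_y. Qed.

Definition TV : Type := {malg K[{fmonom 'I_2}]}.
HB.instance Definition _ := GRing.Lalgebra.on TV.
HB.instance Definition _ := GRing.Lalgebra_isAlgebra.Build K TV
  (@malg_scalerAr K {fmonom 'I_2}).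

Definition TV_inj (v : Vsp) : TV :=
  \sum_(i < 2) (v : 'rV[K]_2) ord0 i *: (<< fmu i >> : TV).

(* The action of g on T(V), by algebra automorphisms. *)
Definition TV_act : TV -> TV :=
  flift (fun w : {fmonom 'I_2} =>
    \prod_(i <- w) TV_inj (gV (delta_mx ord0 i))).

(* A word w of length n has coaction g^n ⊗ w, hence c(w ⊗ v) = g^n v ⊗ w. *)
Definition TV_braid : TV ⊗ TV -> TV ⊗ TV :=
  tlift (fun u v : TV => flift (fun w : {fmonom 'I_2} =>
    iter (fdeg w) TV_act v ⊗ (<< w >> : TV)) u).

(* The coproduct is the algebra map to the braided tensor square of T(V) for  *)
(* which the generators are primitive.                                        *)
Definition TV_comul : TV -> TV ⊗ TV :=
  flift (fun w : {fmonom 'I_2} =>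
    foldr (fun i t =>
        let X := TV_inj (delta_mx ord0 i) in
        bmul TV_braid (X ⊗ 1 + 1 ⊗ X) t)
      (1 ⊗ 1) w).

Definition TV_counit (z : TV) : K := (z : {malg K[{fmonom 'I_2}]})@_mone.

Definition TV_gr (n : nat) (z : TV) : Prop :=
  forall w, w \in msupp (z : {malg K[{fmonom 'I_2}]}) -> fdeg w = n.

Definition TV_pn : preNichols Vsp TV := {|
  pn_hopf := {| braid := TV_braid; comul := TV_comul; counit := TV_counit |};
  pn_gr := TV_gr;
  pn_inj := TV_inj
|}.

Fact TV_counit_linear : linear (TV_counit : TV -> K^o).
Proof. by move=> a u v; rewrite /TV_counit mcoeffD mcoeffZ. Qed.
Fact TV_counitM (u v : TV) : TV_counit (u * v) = TV_counit u * TV_counit v.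
Proof. exact: (mcoeff1g_is_multiplicative _ _).1. Qed.
Fact TV_counit1 : TV_counit 1 = 1.
Proof. by rewrite /TV_counit mcoeff1 eqxx. Qed.
Fact TV_counit_inj v : TV_counit (TV_inj v) = 0.
Proof.
rewrite /TV_counit /TV_inj raddf_sum big1 // => i _.
apply: etrans (mcoeffZ _ _ _) _.
by rewrite mcoeffU1 -fdeg_eq0 fdegU mulr0.
Qed.

Definition jordan_rel (u : TV) : Prop :=
  let x := TV_inj xV in let y := TV_inj yV in
  u = y * x - x * y + 2%:R^-1 *: x ^+ 2.

Fact jordan_rel_counit u : jordan_rel u -> TV_counit u = 0.
Proof.
move=> ->; have [x0 y0] := (TV_counit_inj xV, TV_counit_inj yV).
move: (TV_inj xV) (TV_inj yV) x0 y0 => x y x0 y0.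
have eL := TV_counit_linear.
rewrite addrC eL expr2 TV_counitM x0 mul0r scaler0 add0r addrC -scaleN1r eL.
by rewrite !TV_counitM x0 y0 mul0r scaler0 addr0.
Qed.

Lemma jordan_proper : ~ ideal jordan_rel 1.
Proof.
exact: ideal_proper TV_counit_linear TV_counitM jordan_rel_counit TV_counit1.
Qed.

Definition jordan := aquot jordan_proper.
HB.instance Definition _ := GRing.Algebra.on jordan.

Definition jordan_pn : preNichols Vsp jordan := quot_pn TV_pn jordan_proper.

Definition jx : jordan := pn_inj jordan_pn xV.
Definition jy : jordan := pn_inj jordan_pn yV.

Fact jordan_counit_pi u : counit jordan_pn (api jordan_proper u) = TV_counit u.
Proof.
set v := arepr (api jordan_proper u); rewrite -[LHS]/(TV_counit v).
have uv : ideal jordan_rel (v - u) by apply/(apiE jordan_proper); rewrite areprK.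
have := ideal_kills TV_counit_linear TV_counitM jordan_rel_counit uv.
rewrite addrC -scaleN1r TV_counit_linear scaleN1r addrC => /eqP.
by rewrite subr_eq0 => /eqP.
Qed.
Fact jordan_counit_linear : linear (counit jordan_pn : jordan -> K^o).
Proof.
move=> a q r; rewrite -[q]areprK -[r]areprK -linearP !jordan_counit_pi.
exact: TV_counit_linear.
Qed.
Fact jordan_counitM (q r : jordan) :
  counit jordan_pn (q * r) = counit jordan_pn q * counit jordan_pn r.
Proof.
rewrite -[q]areprK -[r]areprK -rmorphM !jordan_counit_pi.
exact: TV_counitM.
Qed.
Fact jordan_counit1 : counit jordan_pn 1 = 1.
Proof. by rewrite -(rmorph1 (api jordan_proper)) jordan_counit_pi TV_counit1. Qed.

Section G.
Variable p : nat.
Hypothesis charKp : p \in [pchar K].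
Variables k l : nat.

Definition G_rel (u : jordan) : Prop := u = jy ^+ (p ^ k) \/ u = jx ^+ (p ^ l).

Lemma G_proper : ~ ideal G_rel 1.
Proof.
have p_gt0 : (0 < p)%N by exact: prime_gt0 (pcharf_prime charKp).
apply: ideal_proper jordan_counit_linear jordan_counitM _ jordan_counit1.
have nil q m : (0 < m)%N -> counit jordan_pn q = 0 ->
    counit jordan_pn (q ^+ m) = 0.
  by case: m => // m _ q0; rewrite exprS jordan_counitM q0 mul0r.
move=> s [] ->; apply: nil; rewrite ?expn_gt0 ?p_gt0 //.
- by rewrite jordan_counit_pi; apply: TV_counit_inj.
- by rewrite jordan_counit_pi; apply: TV_counit_inj.
Qed.

Definition G := aquot G_proper.
HB.instance Definition _ := GRing.Algebra.on G.

Definition G_pn : preNichols Vsp G := quot_pn jordan_pn G_proper.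

End G.

End TensorAlgebra.

(* Main.v *)
Require Import Defs.
From HB Require Import structures.
From mathcomp Require Import all_boot all_order all_algebra all_field.
From mathcomp Require Import boolp zify.
From mathcomp.multinomials Require Import monalg.

Set Implicit Arguments.
Unset Strict Implicit.
Unset Printing Implicit Defensive.

Import GRing.Theory.

Local Open Scope ring_scope.

(** Write X, Y for the images of x, y in R, h = 1/2, and g for the automorphism
    X |-> X, Y |-> Y + X through which X and Y braid.  They satisfy
    Y X = X Y - h X^2.

    The proof rests on one formula, the coproduct of the monomials X^a Y^b
    ([comul_XaYb]); it says in particular that
    Delta(Y^n) = sum_i binom(n, i) (Y + i h X)^(n - i) ⊗ Y^i.
    Let N be the nilpotency index of X, and n the least positive exponent for
    which Y^n is a combination of the X^(n - b) Y^b with b < n; both exist since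
    R is graded of finite dimension.  Applying (id ⊗ phi) Delta to a relation,
    with phi a functional dual to a power of X, isolates the term of highest
    degree in Y and contradicts the minimality of n.  Hence the X^a Y^b with
    a < N and b < n are linearly independent ([pbw_free]).  The same contraction
    applied to X^N = 0 and to the relation for Y^n shows that
    binom(N, j) = 0 = binom(n, i) in the field for 0 < j < N and 0 < i < n, so
    that N = p^l and n = p^k, and that Y^n = lam X^n for a scalar lam
    ([Y_index_power]).

    The scalar lam can be nonzero, and it is here that the field must be
    algebraically closed: (Y + a X)^n = Y^n + P(a) X^n for a polynomial P of
    degree n, so that some Y' = Y + a X satisfies Y'^n = 0
    ([jordan_shift_pow]).  As a shear of V commutes with its braiding, the
    algebra map G(k, l) -> R sending x to X and y to Y' is a morphism of braided
    Hopf algebras ([G_morphism]); it need not be the identity on V, and the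
    isomorphism of the theorem is one of braided Hopf algebras only.  It is
    bijective, for the p^(k + l) monomials x^a y^b span G(k, l) and their images
    span R, whose dimension is at least p^(k + l) by [pbw_free].

    Uniqueness needs the algebra structure only.  A commutative quotient of
    G(k, l) kills x^2, so p^k-th powers are scalar there, whereas G(k', l') maps
    onto the algebra of a nilpotent shift of index p^k'; and all commutators in
    G(k, l) lie in x^2 G(k, l), which bounds their nilpotency by about half of
    p^l, whereas x survives to the power p^l' - 1 in a representation of
    G(k', l') by weighted shifts. *)

(** * Algebras generated by a Jordan pair *)

Section JordanPairs.
Variables (K : fieldType) (A : algType K) (h : K).

Definition jordan_pair (X Y : A) : Prop := Y * X = X * Y - h *: X ^+ 2.

(** The scalar by which X^j Y^(s - j) occurs in (Y + c X)^s, up to binom(s, j):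
    a falling factorial of c with step h. *)
Definition shift_coef (c : K) (j : nat) : K := \prod_(t < j) (c - h * t%:R).

Variables X Y : A.
Hypothesis XY : jordan_pair X Y.

Let YX : Y * X = X * Y - h *: X ^+ 2. Proof. exact: XY. Qed.

Lemma jordan_shift c : jordan_pair X (Y + c *: X).
Proof.
rewrite /jordan_pair mulrDl mulrDr YX -scalerAl -scalerAr addrAC //.
Qed.

Lemma jordan_YXn n : Y * X ^+ n = X ^+ n * Y - (h * n%:R) *: X ^+ n.+1.
Proof.
elim: n => [|n IHn]; first by rewrite !mulr0 scale0r subr0 mulr1 mul1r.
rewrite {1}exprSr mulrA IHn mulrBl -mulrA YX mulrBr mulrA -exprSr.
rewrite -scalerAr -exprD addn2 -scalerAl -exprSr -addrA -opprD -scalerDl.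
by rewrite -[n.+1%:R]nat1r mulrDr mulr1.
Qed.

(** For h nonzero, in the model X = 1 / (h u), Y = d/du one has
    Y + c X = u^(-c/h) Y u^(c/h), and this is the Leibniz rule for the s-th
    derivative of a product.  The proof is Pascal's rule: moving Y across X^j
    turns the factor c of the added letter into c - h j. *)
Lemma jordan_expand c s :
  (Y + c *: X) ^+ s =
  \sum_(j < s.+1) ('C(s, j)%:R * shift_coef c j) *: (X ^+ j * Y ^+ (s - j)).
Proof.
elim: s => [|s IHs].
  by rewrite big_ord1 /shift_coef big_ord0 !expr0 !mulr1 scale1r.
rewrite exprS IHs mulr_sumr.
have step (j : 'I_s.+1) :
    (Y + c *: X) * (('C(s, j)%:R * shift_coef c j) *: (X ^+ j * Y ^+ (s - j))) =
    ('C(s, j)%:R * shift_coef c j) *: (X ^+ j * Y ^+ (s.+1 - j)) +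
    ('C(s, j)%:R * shift_coef c j.+1) *: (X ^+ j.+1 * Y ^+ (s.+1 - j.+1)).
  rewrite -scalerAr mulrA mulrDl jordan_YXn -scalerAl -exprS.
  rewrite -addrA addrC -scaleNr -scalerDl mulrDl -!scalerAl -mulrA -exprS addrC.
  rewrite scalerDr scalerA subSS (subSn (leq_ord j)) /shift_coef big_ord_recr /=.
  by rewrite mulrA [- _ + c]addrC.
rewrite (eq_bigr _ (fun j _ => step j)) big_split /= big_ord_recl.
rewrite [X in _ + X]big_ord_recr /= [in RHS]big_ord_recl [in RHS]big_ord_recr /=.
rewrite !bin0 !binn -!addrA; congr (_ + _).
rewrite !addrA; congr (_ + _); rewrite -big_split /=; apply: eq_bigr => j _.
by rewrite /bump !add1n binS natrD mulrDl scalerDl.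
Qed.

(** For c = h the falling factorials of length at least 2 vanish. *)
Lemma jordan_expand_h s :
  (Y + h *: X) ^+ s = Y ^+ s + (h * s%:R) *: (X * Y ^+ s.-1).
Proof.
rewrite jordan_expand; case: s => [|s].
  rewrite big_ord1 /shift_coef big_ord0 !expr0 mulr1 scale1r mulr0 scale0r.
  by rewrite addr0 mulr1.
rewrite !big_ord_recl big1 ?addr0 => [|j _]; last first.
  rewrite /shift_coef /bump /= ?add1n !big_ord_recl /= /bump /= ?mulr0 ?subr0.
  by rewrite mulr1 subrr mul0r !mulr0 scale0r.
rewrite /shift_coef big_ord0 big_ord1 /= /bump /= addn0 bin0 bin1 mulr0 subr0 mulr1.
by rewrite scale1r mul1r expr1 subSS subn0 mulrC subn0.
Qed.

Section Spanning.
Hypothesis gen : forall a, subalg (fun z => z = X \/ z = Y) a.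
Variables N n : nat.
Hypothesis n_gt0 : (0 < n)%N.
Hypothesis XN : X ^+ N = 0.
Hypothesis Yn : Y ^+ n = 0.

Let spanned (z : A) := exists e : 'I_N * 'I_n -> K,
  z = \sum_ab e ab *: (X ^+ ab.1 * Y ^+ ab.2).

Let spannedD u v : spanned u -> spanned v -> spanned (u + v).
Proof.
move=> [d ->] [e ->]; exists (fun ab => d ab + e ab).
by rewrite -big_split; apply: eq_bigr => ab _; rewrite scalerDl.
Qed.

Let spannedZ a u : spanned u -> spanned (a *: u).
Proof.
move=> [e ->]; exists (fun ab => a * e ab).
by rewrite scaler_sumr; apply: eq_bigr => ab _; rewrite scalerA.
Qed.

Let spanned0 : spanned 0.
Proof. by exists (fun=> 0); rewrite big1 // => ab _; rewrite scale0r. Qed.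

Let spanned_sum (I : Type) (r : seq I) (P : pred I) (F : I -> A) :
  (forall i, P i -> spanned (F i)) -> spanned (\sum_(i <- r | P i) F i).
Proof. by move=> FP; elim/big_ind: _. Qed.

Let spanned_monomial a b : (b < n)%N -> spanned (X ^+ a * Y ^+ b).
Proof.
move=> b_n; have [a_N|N_a] := ltnP a N; last first.
  by rewrite -(subnK N_a) exprD XN mulr0 mul0r.
exists (fun ab => (ab == (Ordinal a_N, Ordinal b_n))%:R).
rewrite (bigD1 (Ordinal a_N, Ordinal b_n)) //= eqxx scale1r big1 ?addr0 //.
by move=> ab /negPf ->; rewrite scale0r.
Qed.

Let spannedX z : spanned z -> spanned (X * z).
Proof.
move=> [e ->]; rewrite mulr_sumr; apply: spanned_sum => -[a b] _ /=.
by rewrite -scalerAr mulrA -exprS; apply/spannedZ/spanned_monomial.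
Qed.

Let spannedXn a z : spanned z -> spanned (X ^+ a * z).
Proof.
by move=> lz; elim: a => [|a IHa]; rewrite ?mul1r // exprS -mulrA; apply: spannedX.
Qed.

Let spannedY z : spanned z -> spanned (Y * z).
Proof.
move=> [e ->]; rewrite mulr_sumr; apply: spanned_sum => -[a b] _ /=.
rewrite -scalerAr mulrA jordan_YXn mulrBl -mulrA -exprS -scalerAl -scaleNr.
apply/spannedZ/spannedD; last exact/spannedZ/spanned_monomial.
apply: spannedXn; have [b_n|n_b] := ltnP b.+1 n.
  by rewrite -[_ ^+ _]mul1r -(expr0 X); apply: spanned_monomial.
have -> : b.+1 = n by apply/eqP; rewrite eqn_leq n_b andbT.
by rewrite Yn; apply: spanned0.
Qed.

Lemma jordan_span z : exists e : 'I_N * 'I_n -> K,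
  z = \sum_ab e ab *: (X ^+ ab.1 * Y ^+ ab.2).
Proof.
suff: forall w, spanned w -> spanned (z * w).
  move/(_ 1); rewrite mulr1; apply.
  by rewrite -[1]mulr1; exact: (spanned_monomial 0 n_gt0).
elim: (gen z) => [_ [->|->]||u v _ IHu _ IHv|a u _ IHu|u v _ IHu _ IHv] w lw.
- exact: spannedX.
- exact: spannedY.
- by rewrite mul1r.
- by rewrite mulrDl; apply: spannedD; [apply: IHu | apply: IHv].
- by rewrite -scalerAl; apply/spannedZ/IHu.
- by rewrite -mulrA; apply/IHu/IHv.
Qed.

End Spanning.

(** X is normal, so its powers generate two-sided ideals X^m A, and the
    commutator is a biderivation whose value on the generators is a multiple of
    X^2. *)
Section XIdeal.
Hypothesis gen : forall a, subalg (fun z => z = X \/ z = Y) a.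

Let Xid m z := exists u, z = X ^+ m * u.

Lemma Xpow_normal m z : exists u, z * X ^+ m = X ^+ m * u.
Proof.
elim: (gen z) => [_ [->|->]||u v _ [u' eu] _ [v' ev]|a u _ [u' eu]
  |u v _ [u' eu] _ [v' ev]].
- by exists X; rewrite -exprS exprSr.
- exists (Y - (h * m%:R) *: X).
  by rewrite jordan_YXn mulrBr -scalerAr -exprSr.
- by exists 1; rewrite mul1r mulr1.
- by exists (u' + v'); rewrite mulrDl eu ev mulrDr.
- by exists (a *: u'); rewrite -scalerAl eu scalerAr.
- by exists (u' * v'); rewrite -mulrA ev mulrA eu mulrA.
Qed.

Lemma commutator_in_X2 r s : exists u, r * s - s * r = X ^+ 2 * u.
Proof.
have IM z u : Xid 2 u -> Xid 2 (z * u).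
  move=> [v ->]; have [z' e] := Xpow_normal 2 z.
  by exists (z' * v); rewrite mulrA e mulrA.
have IMr z u : Xid 2 u -> Xid 2 (u * z).
  by move=> [v ->]; exists (v * z); rewrite mulrA.
have ID u v : Xid 2 u -> Xid 2 v -> Xid 2 (u + v).
  by move=> [u' ->] [v' ->]; exists (u' + v'); rewrite mulrDr.
have IZ a u : Xid 2 u -> Xid 2 (a *: u).
  by move=> [u' ->]; exists (a *: u'); rewrite scalerAr.
have I0 : Xid 2 0 by exists 0; rewrite mulr0.
have derivation t : (forall z, z = X \/ z = Y -> Xid 2 (z * t - t * z)) ->
    forall z, Xid 2 (z * t - t * z).
  move=> It z; elim: (gen z) => [//||u v _ Iu _ Iv|a u _ Iu|u v _ Iu _ Iv].
  - by rewrite mul1r mulr1 subrr.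
  - by rewrite mulrDl mulrDr opprD addrACA; apply: ID.
  - by rewrite -scalerAl -scalerAr -scalerBr; apply: IZ.
  - rewrite (_ : _ - _ = u * (v * t - t * v) + (u * t - t * u) * v).
      by apply: ID; [apply: IM | apply: IMr].
    by rewrite mulrBr mulrBl !mulrA addrA subrK.
have swap u v : Xid 2 (u * v - v * u) -> Xid 2 (v * u - u * v).
  by move/(IZ (-1)); rewrite scaleN1r opprB.
apply: (derivation) => z [] ->; apply: (swap); apply: (derivation) => {z} z [] ->.
- by rewrite subrr.
- by exists (- h *: 1); rewrite YX addrC addKr -scalerAr mulr1 scaleNr.
- by exists (h *: 1); rewrite YX opprB addrC subrK -scalerAr mulr1.
- by rewrite subrr.
Qed.

Lemma Xpow_ideal_pow m k u : exists v, (X ^+ m * u) ^+ k = X ^+ (m * k) * v.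
Proof.
elim: k => [|k [v IHk]]; first by exists 1; rewrite muln0 mulr1.
have [w e] := Xpow_normal (m * k) u.
by exists (w * v); rewrite exprS IHk -mulrA (mulrA u) e mulnS exprD !mulrA.
Qed.

End XIdeal.
End JordanPairs.

(** * Linear maps on tensor products and on braided tensor squares *)

Section LinearMaps.
Variables (K : fieldType) (U V : lmodType K) (f : U -> V).
Hypothesis f_lin : linear f.

Lemma lin0 : f 0 = 0.
Proof. by have := f_lin (-1) 0 0; rewrite scaler0 addr0 scaleN1r addNr. Qed.

Lemma linZ a u : f (a *: u) = a *: f u.
Proof. by rewrite -[a *: u]addr0 f_lin lin0 addr0. Qed.

Lemma linD u v : f (u + v) = f u + f v.
Proof. by rewrite -[u]scale1r f_lin !scale1r. Qed.

Lemma lin_sum (I : Type) (r : seq I) (P : pred I) (F : I -> U) :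
  f (\sum_(i <- r | P i) F i) = \sum_(i <- r | P i) f (F i).
Proof. exact: (big_morph f linD lin0). Qed.

End LinearMaps.

Lemma comb_linear (K : fieldType) (U V : lmodType K) (k : K) (f g : U -> V) :
  linear f -> linear g -> linear (fun u => k *: f u + g u).
Proof.
move=> fl gl a u v; rewrite fl gl !scalerDr !scalerA [k * a]mulrC.
by rewrite addrACA.
Qed.

Section TensorCalculus.
Variable K : fieldType.
Implicit Types U V W : lmodType K.

Lemma tensDl U V (u u' : U) (v : V) : (u + u') ⊗ v = u ⊗ v + u' ⊗ v.
Proof. exact: linD ((tens_bilin U V).2 v) u u'. Qed.

Lemma tensDr U V (u : U) (v v' : V) : u ⊗ (v + v') = u ⊗ v + u ⊗ v'.
Proof. exact: linD ((tens_bilin U V).1 u) v v'. Qed.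

Lemma tensZr U V (u : U) a (v : V) : u ⊗ (a *: v) = a *: (u ⊗ v).
Proof. exact: linZ ((tens_bilin U V).1 u) a v. Qed.

Lemma tens0l U V (v : V) : (0 : U) ⊗ v = 0.
Proof. exact: lin0 ((tens_bilin U V).2 v). Qed.

Lemma eq_on_tens U V W (f g : U ⊗ V -> W) : linear f -> linear g ->
  (forall u v, f (u ⊗ v) = g (u ⊗ v)) -> f =1 g.
Proof.
move=> fl gl fg; apply: tensor_ind => //; first by rewrite !lin0.
by move=> s t es et; rewrite !linD // es et.
Qed.

(** The lift along an arbitrary f is computed on a chosen representative, and L
    commutes with that computation.  So the structure maps of a quotient, which
    are defined by representatives, can be transported along L before they are
    known to be well defined. *)
Lemma lin_tlift U V W W' (L : W -> W') (f : U -> V -> W) t : linear L ->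
  L (tlift f t) = tlift (fun u v => L (f u v)) t.
Proof.
move=> Ll; rewrite tlift.unlock /flift lin_sum //.
by apply: eq_bigr => i _; rewrite linZ.
Qed.

Lemma eq_tlift U V W (f g : U -> V -> W) t :
  (forall u v, f u v = g u v) -> tlift f t = tlift g t.
Proof.
move=> fg; rewrite tlift.unlock /flift.
by apply: eq_bigr => i _; rewrite fg.
Qed.

Lemma bilin_tens2 U V U' V' (f : U -> U') (g : V -> V') :
  linear f -> linear g -> bilin (fun u v => f u ⊗ g v).
Proof.
move=> fl gl; split=> [u a v v'|v a u u'].
  by rewrite gl tensDr tensZr.
by rewrite /= fl tensDl tensZl.
Qed.

Lemma tmap_tens U V U' V' (f : U -> U') (g : V -> V') u v :
  linear f -> linear g -> tmap f g (u ⊗ v) = f u ⊗ g v.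
Proof. by move=> fl gl; rewrite /tmap tlift_tens //; apply: bilin_tens2. Qed.

Lemma tmap_linear U V U' V' (f : U -> U') (g : V -> V') :
  linear f -> linear g -> linear (tmap f g).
Proof. by move=> fl gl; apply/tlift_linear/bilin_tens2. Qed.

Lemma comp_linear U V W (f : U -> V) (g : V -> W) :
  linear f -> linear g -> linear (g \o f).
Proof. by move=> fl gl a u v; rewrite /= fl gl. Qed.

Lemma tmap_comp U V U' V' U'' V'' (f : U -> U') (g : V -> V')
    (f' : U' -> U'') (g' : V' -> V'') t :
  linear f -> linear g -> linear f' -> linear g' ->
  tmap f' g' (tmap f g t) = tmap (f' \o f) (g' \o g) t.
Proof.
move=> fl gl fl' gl'; pattern t.
apply: (@eq_on_tens _ _ _ (tmap f' g' \o tmap f g)).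
- by apply: comp_linear; apply: tmap_linear.
- by apply: tmap_linear; apply: comp_linear.
by move=> u v; rewrite /= !tmap_tens //; apply: comp_linear.
Qed.

Lemma tmap_id U V (f : U -> U) (g : V -> V) t :
  f =1 id -> g =1 id -> tmap f g t = t.
Proof.
move=> fid gid; rewrite /tmap; under eq_tlift do rewrite fid gid.
pattern t; apply: (@eq_on_tens _ _ _ (tlift (fun u v => u ⊗ v))) => //.
  exact: tlift_linear (tens_bilin _ _).
by move=> u v; rewrite tlift_tens //; apply: tens_bilin.
Qed.

Lemma tmul_tens (A : algType K) (a b : A) : tmul (a ⊗ b) = a * b.
Proof.
rewrite /tmul tlift_tens //; split=> [u k v v'|v k u u'] /=.
  by rewrite mulrDr scalerAr.
by rewrite mulrDl scalerAl.
Qed.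

Lemma tmul_linear (A : algType K) : linear (@tmul K A).
Proof.
apply: tlift_linear; split=> [u k v v'|v k u u'] /=.
  by rewrite mulrDr scalerAr.
by rewrite mulrDl scalerAl.
Qed.

Lemma tassoc_tens U V W (u : U) (v : V) (w : W) :
  tassoc (u ⊗ v ⊗ w) = u ⊗ (v ⊗ w).
Proof.
have b1 x : bilin (fun (u : U) (v : V) => u ⊗ (v ⊗ (x : W))).
  split=> [a k b b'|a k b b']; first by rewrite tensDl tensDr tensZl tensZr.
  by rewrite /= tensDl tensZl.
rewrite /tassoc tlift_tens ?tlift_tens //.
split=> [t|x]; last exact: tlift_linear.
move=> k a b; pattern t.
apply: (@eq_on_tens _ _ _ (tlift (fun u0 v0 => u0 ⊗ (v0 ⊗ (k *: a + b))))
  (fun t => k *: tlift (fun u0 v0 => u0 ⊗ (v0 ⊗ a)) t +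
            tlift (fun u0 v0 => u0 ⊗ (v0 ⊗ b)) t)).
- exact: tlift_linear.
- by apply: comb_linear; apply: tlift_linear.
- by move=> s s'; rewrite !tlift_tens // !tensDr !tensZr.
Qed.

Lemma tassocV_tens U V W (u : U) (v : V) (w : W) :
  tassocV (u ⊗ (v ⊗ w)) = u ⊗ v ⊗ w.
Proof.
have b1 x : bilin (fun (v : V) (w : W) => (x : U) ⊗ v ⊗ w).
  split=> [a k b b'|a k b b']; first by rewrite !(tensDr, tensZr).
  by rewrite /= tensDr tensZr tensDl tensZl.
rewrite /tassocV tlift_tens ?tlift_tens //.
split=> [x|t]; first exact: tlift_linear.
move=> k a b; pattern t.
apply: (@eq_on_tens _ _ _ (tlift (fun v0 w0 => (k *: a + b) ⊗ v0 ⊗ w0))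
  (fun t => k *: tlift (fun v0 w0 => a ⊗ v0 ⊗ w0) t +
            tlift (fun v0 w0 => b ⊗ v0 ⊗ w0) t)).
- exact: tlift_linear.
- by apply: comb_linear; apply: tlift_linear.
- by move=> s s'; rewrite !tlift_tens // !tensDl !tensZl.
Qed.

Section BraidedSquare.
Variables (A : algType K) (c : A ⊗ A -> A ⊗ A).
Hypothesis c_lin : linear c.

Let inner_bilin a e :
  bilin (fun d' b' : A => (a * d') ⊗ (b' * e)).
Proof.
split=> [u k v v'|v k u u'].
  by rewrite mulrDl -scalerAl tensDr tensZr.
by rewrite /= mulrDr -scalerAr tensDl tensZl.
Qed.

Let middle_bilin a b : bilin (fun d e : A =>
  tlift (fun d' b' => (a * d') ⊗ (b' * e)) (c (b ⊗ d))).
Proof.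
split=> [d k e e'|e k d d'] /=; last first.
  by rewrite tensDr tensZr linD // linZ // (tlift_linear (inner_bilin _ _)).
move: (c _) => t; pattern t.
apply: (@eq_on_tens _ _ _ (tlift _)
  (fun t => k *: tlift (fun d' b' => (a * d') ⊗ (b' * e)) t +
            tlift (fun d' b' => (a * d') ⊗ (b' * e')) t)).
- exact: tlift_linear.
- by apply: comb_linear; apply: tlift_linear.
- move=> s s'; rewrite !tlift_tens ?mulrDr ?tensDr -?scalerAr ?tensZr //.
Qed.

Let outer_bilin t : bilin (fun a b : A => tlift (fun d e : A =>
  tlift (fun d' b' => (a * d') ⊗ (b' * e)) (c (b ⊗ d))) t).
Proof.
split=> [a|b] k x y.
  pattern t; apply: (@eq_on_tens _ _ _ (tlift _)
    (fun t => k *: tlift (fun d e : A =>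
       tlift (fun d' b' => (a * d') ⊗ (b' * e)) (c (x ⊗ d))) t +
     tlift (fun d e : A =>
       tlift (fun d' b' => (a * d') ⊗ (b' * e)) (c (y ⊗ d))) t)).
  - exact: tlift_linear.
  - by apply: comb_linear; apply: tlift_linear.
  - move=> d e; rewrite !tlift_tens // tensDl tensZl linD // linZ //.
    by rewrite (tlift_linear (inner_bilin _ _)).
pattern t; apply: (@eq_on_tens _ _ _ (tlift _)
  (fun t => k *: tlift (fun d e : A =>
     tlift (fun d' b' => (x * d') ⊗ (b' * e)) (c (b ⊗ d))) t +
   tlift (fun d e : A =>
     tlift (fun d' b' => (y * d') ⊗ (b' * e)) (c (b ⊗ d))) t)).
- exact: tlift_linear.
- by apply: comb_linear; apply: tlift_linear.
- move=> d e; rewrite !tlift_tens //; move: (c _) => w; pattern w.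
  apply: (@eq_on_tens _ _ _ (tlift _)
    (fun w => k *: tlift (fun d' b' => (x * d') ⊗ (b' * e)) w +
              tlift (fun d' b' => (y * d') ⊗ (b' * e)) w)).
  + exact: tlift_linear.
  + by apply: comb_linear; apply: tlift_linear.
  + move=> s s'; rewrite !tlift_tens // mulrDl -scalerAl tensDl tensZl //.
Qed.

Lemma bmul_linearr s : linear (bmul c s).
Proof.
move=> k t t'; rewrite /bmul; pattern s.
apply: (@eq_on_tens _ _ _ (tlift _) (fun s => k *: bmul c s t + bmul c s t')).
- exact: tlift_linear.
- by apply: comb_linear; apply: tlift_linear.
- move=> a b; rewrite /bmul !tlift_tens //.
  by rewrite (tlift_linear (middle_bilin _ _)).
Qed.

Lemma bmul_linearl t : linear (bmul c ^~ t).
Proof. exact: tlift_linear. Qed.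

(** The braiding enters the product of two pure tensors only through its value
    on the inner factors, which is a pure tensor in every use below. *)
Lemma bmul_tens a b d e d' b' : c (b ⊗ d) = d' ⊗ b' ->
  bmul c (a ⊗ b) (d ⊗ e) = (a * d') ⊗ (b' * e).
Proof. by move=> cbd; rewrite /bmul !tlift_tens // cbd tlift_tens. Qed.

End BraidedSquare.
End TensorCalculus.

(** * Universal properties of the tensor algebra, the Jordan plane and G(k, l) *)

Section QuotientLift.
Variables (K : fieldType) (A B : algType K) (S : A -> Prop).
Variables (S_proper : ~ ideal S 1) (f : {lrmorphism A -> B}).
Hypothesis fS : forall s, S s -> f s = 0.

Let f_ideal u : ideal S u -> f u = 0.
Proof.
elim=> [_ [a [b [s [/fS fs ->]]]]||v w _ fv _ fw|a v _ fv].
- by rewrite !rmorphM /= fs mulr0 mul0r.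
- by rewrite rmorph0.
- by rewrite rmorphD /= fv fw addr0.
- by rewrite linearZ /= fv scaler0.
Qed.

Lemma aquot_lift :
  exists g : {lrmorphism aquot S_proper -> B}, forall a, g (api S_proper a) = f a.
Proof.
pose g (q : aquot S_proper) := f (arepr q).
have gE a : g (api S_proper a) = f a.
  apply/eqP; rewrite -subr_eq0 -rmorphB; apply/eqP/f_ideal.
  by apply/(apiE S_proper); rewrite areprK.
have g_lin : linear g.
  by move=> a q r; rewrite -[q]areprK -[r]areprK -linearP !gE linearP.
have g_mul : monoid_morphism g.
  split=> [|q r]; first by rewrite -(rmorph1 (api S_proper)) gE rmorph1.
  by rewrite -[q]areprK -[r]areprK -rmorphM !gE rmorphM.
pose gL := GRing.isLinear.Build K _ _ _ g g_lin.
pose gM := GRing.isMonoidMorphism.Build _ _ g g_mul.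
pose G : {lrmorphism aquot S_proper -> B} := HB.pack g gL gM.
by exists G.
Qed.

End QuotientLift.

Section Generation.
Variables (K : fieldType) (A : algType K).

Lemma subalg_im (B : algType K) (f : {lrmorphism A -> B}) (S : A -> Prop)
    (T : B -> Prop) a :
  (forall s, S s -> subalg T (f s)) -> subalg S a -> subalg T (f a).
Proof.
move=> ST; elim=> [u /ST//||u v _ Tu _ Tv|k u _ Tu|u v _ Tu _ Tv].
- by rewrite rmorph1; apply: subalg1.
- by rewrite rmorphD; apply: subalgD.
- by rewrite linearZ; apply: subalgZ.
- by rewrite rmorphM; apply: subalgM.
Qed.

End Generation.

Lemma malgUZ (K : fieldType) (I : choiceType) (a : K) (i : I) :
  << a *g i >> = a *: << i >> :> {malg K[I]}.
Proof. by apply/malgP=> j; rewrite mcoeffZ !mcoeffU mulrnAr mulr1. Qed.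

Section MulMorphComb.
Variables (K : fieldType) (A B : algType K) (f : A -> B).
Hypothesis f_lin : linear f.

Lemma mul_morph_combl k u u' v : f (u * v) = f u * f v ->
  f (u' * v) = f u' * f v -> f ((k *: u + u') * v) = f (k *: u + u') * f v.
Proof. by move=> e e'; rewrite mulrDl -scalerAl !f_lin e e' mulrDl scalerAl. Qed.

Lemma mul_morph_combr k u v v' : f (u * v) = f u * f v ->
  f (u * v') = f u * f v' -> f (u * (k *: v + v')) = f u * f (k *: v + v').
Proof. by move=> e e'; rewrite mulrDr -scalerAr !f_lin e e' mulrDr scalerAr. Qed.

End MulMorphComb.

Section JordanPairMorphisms.
Variables (K : fieldType) (A B : algType K) (f : {lrmorphism A -> B}) (h : K).
Variables X Y : A.

Lemma jordan_pair_im0 : jordan_pair h (f X) (f Y) <->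
  f (Y * X - X * Y + h *: X ^+ 2) = 0.
Proof.
rewrite /jordan_pair !expr2 rmorphD rmorphB /= (linZ (linearP f)) !rmorphM /=.
split=> [->|/eqP]; first by rewrite addrAC subrK subrr.
by rewrite -addrA addr_eq0 opprD opprK => /eqP.
Qed.

Lemma jordan_pair_im :
  f (Y * X - X * Y + h *: X ^+ 2) = 0 -> jordan_pair h (f X) (f Y).
Proof. by move/jordan_pair_im0. Qed.

Lemma jordan_pair_rmorph (X' Y' : B) : f X = X' -> f Y = Y' ->
  jordan_pair h X Y -> jordan_pair h X' Y'.
Proof.
move=> <- <- XY; apply: jordan_pair_im.
have YX : Y * X = X * Y - h *: X ^+ 2 := XY.
by rewrite YX addrAC subrK subrr rmorph0.
Qed.

End JordanPairMorphisms.

Lemma ord2P (i : 'I_2) : i = ord0 \/ i = ord_max.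
Proof.
by case: i => [[|[|]]] // i_lt2; [left | right]; apply: val_inj.
Qed.

Section TensorAlgebraLift.
Variable K : fieldType.
Local Notation TV := (TV K).

Definition word (w : {fmonom 'I_2}) : TV := << w >>.
Definition letter (i : 'I_2) : TV := word (fmu i).

Lemma word_one : word mone = 1. Proof. by []. Qed.

Lemma wordM v w : word (mmul v w) = word v * word w.
Proof. by rewrite /word malgM_def fgmulUU mulr1. Qed.

Lemma word_seq (s : seq 'I_2) : word (FMonom s) = \prod_(i <- s) letter i.
Proof.
elim: s => [|i s IHs]; first by rewrite big_nil -word_one /word -fmoneE.
rewrite big_cons -IHs -wordM; congr word; apply/eqP.
by rewrite fmP fmM fmU.
Qed.

Lemma TV_ind (P : TV -> Prop) :
  (forall s, P (word (FMonom s))) -> P 0 ->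
  (forall a u v, P u -> P v -> P (a *: u + v)) -> forall u, P u.
Proof.
move=> Pw P0 PL u; rewrite (monalgE u).
have PZ a (w : {fmonom 'I_2}) : P << a *g w >>.
  rewrite malgUZ -[_ *: _]addr0.
  by apply: (PL a (word w) 0) => //; case: w.
elim/big_ind: _ => // v w Pv Pw'.
by rewrite -[v]scale1r; apply: PL.
Qed.

Lemma TV_gen u : subalg (fun z => exists i, z = letter i) u.
Proof.
elim/TV_ind: u => [s||a u v Tu Tv].
- rewrite word_seq; elim/big_ind: _ => [|v w|i _].
  + exact: subalg1.
  + exact: subalgM.
  + by apply: subalg_mem; exists i.
- by rewrite -(scale0r 1); apply/subalgZ/subalg1.
- by apply: subalgD => //; apply: subalgZ.
Qed.

Lemma TV_inj_delta i : TV_inj (delta_mx ord0 i : Vsp K) = letter i.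
Proof.
rewrite /TV_inj (bigD1 i) //= big1 => [|j /negPf ji].
  by rewrite !mxE !eqxx scale1r addr0.
by rewrite mxE ji scale0r.
Qed.

Section Lift.
Variables (A : algType K) (a : 'I_2 -> A).

Definition TV_eval : TV -> A :=
  flift (fun w : {fmonom 'I_2} => \prod_(i <- w) a i).

Fact TV_eval_linear : linear TV_eval.
Proof. exact: flift_is_linear. Qed.
HB.instance Definition _ := GRing.isLinear.Build K TV A *:%R TV_eval TV_eval_linear.

Lemma TV_eval_word w : TV_eval (word w) = \prod_(i <- w) a i.
Proof. exact: fliftU. Qed.

Fact TV_eval_monoid : monoid_morphism TV_eval.
Proof.
split=> [|u v]; first by rewrite -word_one TV_eval_word fm1 big_nil.
elim/TV_ind: u => [s||k u u' IHu IHu'].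
- elim/TV_ind: v => [t||k v v' IHv IHv'].
  + by rewrite -wordM !TV_eval_word fmM big_cat.
  + by rewrite mulr0 !linear0 mulr0.
  + exact: (mul_morph_combr TV_eval_linear).
- by rewrite mul0r linear0 mul0r.
- exact: (mul_morph_combl TV_eval_linear).
Qed.
HB.instance Definition _ := GRing.isMonoidMorphism.Build TV A TV_eval TV_eval_monoid.

Lemma TV_eval_letter i : TV_eval (letter i) = a i.
Proof. by rewrite TV_eval_word fmU big_seq1. Qed.

End Lift.

Local Notation half := (2%:R^-1 : K).

Lemma jordan_pair_jordan : jordan_pair half (jx K) (jy K).
Proof.
apply: (@jordan_pair_im _ _ _ (api (@jordan_proper K))).
rewrite -(rmorph0 (api (@jordan_proper K))).
apply/(apiE (@jordan_proper K)); rewrite subr0.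
exact: ideal_mem.
Qed.

Lemma jordan_gen u : subalg (fun z => z = jx K \/ z = jy K) u.
Proof.
rewrite -[u]areprK; apply: subalg_im (TV_gen _) => _ [i ->].
rewrite -TV_inj_delta; apply: subalg_mem.
have [->|->] := ord2P i.
- by left.
- by right.
Qed.

Lemma jordan_lift (A : algType K) (X Y : A) : jordan_pair half X Y ->
  exists2 f : {lrmorphism jordan K -> A}, f (jx K) = X & f (jy K) = Y.
Proof.
move=> XY; pose a (i : 'I_2) := if i == ord0 then X else Y.
have eX : TV_eval a (TV_inj (xV K)) = X by rewrite TV_inj_delta TV_eval_letter.
have eY : TV_eval a (TV_inj (yV K)) = Y by rewrite TV_inj_delta TV_eval_letter.
have [|f fE] := @aquot_lift _ _ _ _ (@jordan_proper K) (TV_eval a).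
  have XY' : jordan_pair half (TV_eval a (TV_inj (xV K)))
    (TV_eval a (TV_inj (yV K))).
    suff: forall X' Y', X' = X -> Y' = Y -> jordan_pair half X' Y'.
      by apply; [exact: eX | exact: eY].
    by move=> _ _ -> ->.
  move=> _ ->; exact: (jordan_pair_im0 (TV_eval a) _ _ _).1 XY'.
by exists f; [rewrite -eX -fE | rewrite -eY -fE].
Qed.

Section G.
Variables (p : nat) (charKp : p \in [pchar K]) (k l : nat).
Local Notation G := (G charKp k l).

Definition gx : G := pn_inj (G_pn charKp k l) (xV K).
Definition gy : G := pn_inj (G_pn charKp k l) (yV K).

Lemma G_lift (A : algType K) (X Y : A) : jordan_pair half X Y ->
    X ^+ (p ^ l) = 0 -> Y ^+ (p ^ k) = 0 ->
  exists2 f : {lrmorphism G -> A}, f gx = X & f gy = Y.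
Proof.
move=> XY Xl Yk; have [f fx fy] := jordan_lift XY.
have [|g gE] := @aquot_lift _ _ _ _ (@G_proper K p charKp k l) f.
  have fX z Z n : f z = Z -> Z ^+ n = 0 -> f (z ^+ n) = 0.
    by move=> <- <-; apply: rmorphXn.
  by move=> s [] ->; [apply: fX fy Yk | apply: fX fx Xl].
by exists g; [rewrite -fx -gE | rewrite -fy -gE].
Qed.

Lemma G_gen u : subalg (fun z => z = gx \/ z = gy) u.
Proof.
rewrite -[u]areprK; apply: subalg_im (jordan_gen _) => _ [] ->.
- by apply: subalg_mem; left.
- by apply: subalg_mem; right.
Qed.

Lemma jordan_pair_G : jordan_pair half gx gy.
Proof.
exact: (jordan_pair_rmorph (f := api (@G_proper K p charKp k l))
  erefl erefl jordan_pair_jordan).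
Qed.

Lemma gx_pow : gx ^+ (p ^ l) = 0.
Proof.
transitivity (api (@G_proper K p charKp k l) (jx K ^+ (p ^ l))).
  by rewrite rmorphXn.
rewrite -(rmorph0 (api (@G_proper K p charKp k l))).
apply/(apiE (@G_proper K p charKp k l)); rewrite subr0.
by apply: ideal_mem; right.
Qed.

Lemma gy_pow : gy ^+ (p ^ k) = 0.
Proof.
transitivity (api (@G_proper K p charKp k l) (jy K ^+ (p ^ k))).
  by rewrite rmorphXn.
rewrite -(rmorph0 (api (@G_proper K p charKp k l))).
apply/(apiE (@G_proper K p charKp k l)); rewrite subr0.
by apply: ideal_mem; left.
Qed.

End G.
End TensorAlgebraLift.

(** * The exponents k and l are invariants of the algebra G(k, l) *)

Section WeightedShift.
Variables (K : fieldType) (n : nat).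

(** Row vectors are shifted to the right: e_i is sent to w_i e_(i + 1). *)
Definition wshift (w : nat -> K) : 'M[K]_n.+1 :=
  \matrix_(i, j) (w i *+ (j == i.+1 :> nat)).

Lemma wshift_mulE v w (m : nat) :
  (\matrix_(i, j) (v i *+ (j == i + m :> nat)%N)) * wshift w =
  \matrix_(i, j) ((v i * w (i + m)%N) *+ (j == i + m.+1 :> nat)%N) :> 'M[K]_n.+1.
Proof.
apply/matrixP=> i j; rewrite !mxE.
have [im_n|n_im] := ltnP (i + m) n.+1; last first.
  rewrite big1 => [|s _]; last first.
    rewrite !mxE (_ : _ == _ = false) ?mulr0n ?mul0r //.
    by apply/eqP=> e; move: (ltn_ord s); rewrite e ltnNge n_im.
  rewrite (_ : _ == _ = false) ?mulr0n //.
  apply/eqP=> e; move: (ltn_ord j); rewrite e addnS ltnNge.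
  by rewrite (leq_trans n_im).
rewrite (bigD1 (Ordinal im_n)) //= !mxE eqxx addnS big1 ?addr0 => [|s].
  by rewrite mulrnAr.
by rewrite -val_eqE !mxE /= => /negPf ->; rewrite mulr0n mul0r.
Qed.

Lemma wshift_expE w m : wshift w ^+ m =
  \matrix_(i, j) ((\prod_(t < m) w (i + t)%N) *+ (j == i + m :> nat)%N).
Proof.
elim: m => [|m IHm].
  apply/matrixP=> i j; rewrite !mxE big_ord0 addn0 eq_sym.
  by rewrite -val_eqE.
rewrite exprSr IHm wshift_mulE; apply/matrixP=> i j; rewrite !mxE.
by rewrite big_ord_recr.
Qed.

Lemma wshift_nil w : wshift w ^+ n.+1 = 0.
Proof.
rewrite wshift_expE; apply/matrixP=> i j; rewrite !mxE.
by rewrite (_ : _ == _ = false) // ltn_eqF // ltn_addl.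
Qed.

Lemma wshift1_pow_entry m (mn : (m < n.+1)%N) :
  (wshift (fun=> 1) ^+ m) ord0 (Ordinal mn) = 1.
Proof. by rewrite wshift_expE mxE big1 //= eqxx. Qed.

(** With e_i = x^i, this is the right action on K[x] / (x^(n + 1)) of x by
    multiplication and of y by the derivation h x^2 d/dx. *)
Lemma jordan_pair_wshift (h : K) :
  jordan_pair h (wshift (fun=> 1)) (wshift (fun i => h * i%:R)).
Proof.
rewrite /jordan_pair wshift_expE.
have e w : wshift w = \matrix_(i, j) (w i *+ (j == i + 1 :> nat)%N).
  by apply/matrixP=> i j; rewrite !mxE addn1.
rewrite {1}[wshift (fun i => _)]e {2}[wshift (fun=> _)]e !wshift_mulE.
apply/matrixP=> i j; rewrite !mxE big1 //.
case: eqP => _; last by rewrite !mulr0n mulr0 subrr.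
by rewrite addn1 -[i.+1%:R]natr1 !mulr1 mul1r !mulr1n mulrDr mulr1 addrK.
Qed.

End WeightedShift.

Section Uniqueness.
Variables (K : fieldType) (p : nat) (charKp : p \in [pchar K]).
Hypothesis p_gt2 : (2 < p)%N.
Local Notation half := (2%:R^-1 : K).

Lemma two_neq0 : 2%:R != 0 :> K.
Proof.
by rewrite -(dvdn_pcharf charKp) gtnNdvd.
Qed.

Lemma Frobenius_comm (A : algType K) (u v : A) k : GRing.comm u v ->
  (u + v) ^+ (p ^ k) = u ^+ (p ^ k) + v ^+ (p ^ k).
Proof.
have charA : p \in [pchar A].
  rewrite inE (pcharf_prime charKp) /= -scaler_nat.
  by rewrite (pcharf0 charKp) scale0r.
move=> cuv; elim: k => [|k IHk]; first by rewrite !expn0 !expr1.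
rewrite expnSr !exprM IHk -!(pFrobenius_autE charA).
by apply: pFrobenius_autD_comm; apply/commrX/commr_sym/commrX/commr_sym.
Qed.

Lemma jordan_pair_comm (A : algType K) (h : K) (X Y : A) :
  GRing.comm X Y -> h != 0 -> jordan_pair h X Y -> X ^+ 2 = 0.
Proof.
move=> cXY h0 XY; have YX : Y * X = X * Y - h *: X ^+ 2 := XY.
have : X * Y - (X * Y - h *: X ^+ 2) = 0 by rewrite -YX -cXY subrr.
rewrite subKr => /eqP; rewrite scaler_eq0 (negPf h0) => /eqP //.
Qed.

Lemma jordan_commutator_pow (A : algType K) (h : K) (X Y : A) m :
  jordan_pair h X Y -> (X * Y - Y * X) ^+ m = h ^+ m *: X ^+ (2 * m).
Proof.
move=> XY; have -> : Y * X = X * Y - h *: X ^+ 2 := XY.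
by rewrite subKr exprZn exprM.
Qed.

Lemma rmorph_commutator_nil (A B : algType K) (f : {lrmorphism A -> B})
    (r s : A) (x y : B) m : f r = x -> f s = y ->
  (r * s - s * r) ^+ m = 0 -> (x * y - y * x) ^+ m = 0.
Proof.
by move=> <- <- e; rewrite -!rmorphM -rmorphB -rmorphXn e rmorph0.
Qed.

Section Centralizer.
Variables (A B : algType K) (S : A -> Prop) (f : {lrmorphism A -> B}) (b : B).

Lemma comm_subalg a : (forall s, S s -> GRing.comm b (f s)) ->
  subalg S a -> GRing.comm b (f a).
Proof.
move=> bS; elim=> [//||u v _ bu _ bv|k u _ bu|u v _ bu _ bv].
- by rewrite rmorph1; apply: commr1.
- by rewrite rmorphD; apply: commrD.
- by rewrite linearZ /GRing.comm /= -scalerAr bu scalerAl.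
- by rewrite rmorphM; apply: commrM.
Qed.

End Centralizer.

Variables k l k' l' : nat.
Local Notation G := (Defs.G charKp k l).
Local Notation G' := (Defs.G charKp k' l').
Variable t : {lrmorphism G -> G'}.
Hypothesis t_surj : forall g', exists g, t g = g'.

Let p_gt0 : (0 < p)%N. Proof. exact: ltn_trans p_gt2. Qed.
Let p_gt1 : (1 < p)%N. Proof. exact: ltn_trans p_gt2. Qed.

(** Compose t with the map G' -> matrices sending x to 0 and y to a nilpotent
    shift J of index p^k'.  Its image is commutative, so the image of x has
    square zero, the p^k-th power map is additive and multiplicative, and p^k-th
    powers of all elements are scalar.  As J is one of these elements, its
    power J^(p^k) is scalar, which forces p^k' <= p^k. *)
Lemma G_surjection_k : (0 < k)%N -> (k' <= k)%N.
Proof.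
move=> k_gt0.
pose n := (p ^ k').-1.
have nE : n.+1 = (p ^ k')%N by rewrite prednK ?expn_gt0 ?p_gt0.
pose J := wshift n (fun=> 1 : K).
have J0 : jordan_pair half 0 J.
  by rewrite /jordan_pair mul0r mulr0 expr0n scaler0 subr0.
have [||h1 h1x h1y] := @G_lift K p charKp k' l' _ 0 J J0.
- by rewrite expr0n expn_eq0 -leqn0 leqNgt p_gt0.
- by rewrite -nE wshift_nil.
have cJ u : GRing.comm J (h1 u).
  apply: (comm_subalg _ (G_gen u)) => _ [] ->; first by rewrite h1x; apply: commr0.
  by rewrite h1y.
have ch u v : GRing.comm (h1 u) (h1 v).
  apply: (comm_subalg _ (G_gen v)) => _ [] ->; first by rewrite h1x; apply: commr0.
  by rewrite h1y; apply: commr_sym.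
pose h u := h1 (t u).
have hX u m : h (u ^+ m) = h u ^+ m.
  by rewrite /h /= !rmorphXn.
have scalar u : exists c, h u ^+ (p ^ k) = c *: 1.
  have pk_gt1 : (1 < p ^ k)%N by rewrite -{1}(expn0 p) ltn_exp2l.
  elim: (G_gen u) => [_ [->|->]||v w _ [c ev] _ [d ew]|a v _ [c ev]
    |v w _ [c ev] _ [d ew]].
  - exists 0; rewrite scale0r -(subnK pk_gt1) exprD.
    suff -> : h (gx charKp k l) ^+ 2 = 0 by rewrite mulr0.
    apply: (@jordan_pair_comm _ half (h1 (t _)) (h1 (t (gy charKp k l)))).
    - exact: ch.
    - by rewrite invr_eq0 two_neq0.
    - exact: jordan_pair_rmorph erefl erefl
        (jordan_pair_rmorph (f := t) erefl erefl (jordan_pair_G charKp k l)).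
  - by exists 0; rewrite -hX gy_pow scale0r /h /= !rmorph0.
  - by exists 1; rewrite /h /= !rmorph1 expr1n scale1r.
  - exists (c + d); rewrite /h /= !rmorphD Frobenius_comm; last exact: ch.
    by rewrite scalerDl; congr (_ + _).
  - exists (a ^+ (p ^ k) * c); rewrite /h /= !linearZ /= exprZn.
    by rewrite -scalerA; congr (_ *: _).
  - exists (c * d); rewrite /h /= !rmorphM exprMn_comm; last exact: ch.
    rewrite [X in X * _]ev [X in _ * X]ew -scalerAl mul1r scalerA //.
have [y ty] := t_surj (gy charKp k' l').
have [c] := scalar y; rewrite /h /= ty h1y => Jc.
rewrite leqNgt; apply/negP=> kk'.
have pkn : (p ^ k < n.+1)%N by rewrite nE ltn_exp2l.
have /matrixP/(_ ord0 (Ordinal pkn)) := Jc.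
rewrite wshift1_pow_entry !mxE -val_eqE /=.
rewrite (_ : 0%N == _ = false) ?mulr0 => [/eqP|]; first by rewrite oner_eq0.
by rewrite eq_sym expn_eq0 -leqn0 leqNgt p_gt0.
Qed.

(** An entry of the p^k'-th power is a product of p^k' consecutive integers,
    up to a power of the half, and one of them is divisible by p. *)
Lemma wshift_half_nil n : (0 < k')%N ->
  wshift n (fun i => half * i%:R) ^+ (p ^ k') = 0.
Proof.
move=> k'_gt0; rewrite wshift_expE; apply/matrixP=> i j; rewrite !mxE.
suff -> : \prod_(s < p ^ k') (half * (i + s)%:R) = 0 by rewrite mul0rn.
(* the least s for which p divides i + s *)
have s_lt : ((p - i %% p) %% p < p ^ k')%N.
  by apply: leq_trans (ltn_pmod _ p_gt0) _; rewrite -{1}(expn1 p) leq_exp2l.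
rewrite (bigD1 (Ordinal s_lt)) //= [(i + _)%:R](_ : _ = 0) ?mulr0 ?mul0r //.
apply/eqP; rewrite -(dvdn_pcharf charKp) /dvdn modnDmr -modnDml.
by rewrite subnKC ?modnn // ltnW // ltn_pmod.
Qed.

(** Commutators in G lie in x^2 G, so their m-th powers vanish as soon as
    2 m >= p^l.  In the representation of G' by weighted shifts the commutator
    of y and x is a multiple of x^2, where x is a shift of index p^l'.  Thus
    p^l' <= 2 m <= p^l + 1, and p > 2 gives l' <= l. *)
Lemma G_surjection_l : (0 < k')%N -> (l' <= l)%N.
Proof.
move=> k'_gt0.
pose n := (p ^ l').-1.
have nE : n.+1 = (p ^ l')%N by rewrite prednK ?expn_gt0 ?p_gt0.
have [||h2 h2x h2y] := G_lift charKp (k := k') (l := l') (jordan_pair_wshift n half).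
- by rewrite -nE wshift_nil.
- exact: wshift_half_nil.
pose m := uphalf (p ^ l).
have m_ge : (p ^ l <= 2 * m)%N by rewrite mul2n -leq_uphalf_double.
have m_le : (2 * m <= (p ^ l).+1)%N.
  have := odd_double_half (p ^ l); rewrite /m uphalf_half -muln2.
  by case: odd; lia.
have comm_nil r s : (r * s - s * r) ^+ m = 0 :> G.
  have [u ->] := commutator_in_X2 (jordan_pair_G charKp k l) (G_gen (l := l)) r s.
  have [v ->] := Xpow_ideal_pow (jordan_pair_G charKp k l) (G_gen (l := l)) 2 m u.
  by rewrite -(subnK m_ge) addnC exprD gx_pow !mul0r.
have [x tx] := t_surj (gx charKp k' l').
have [y ty] := t_surj (gy charKp k' l').
have := rmorph_commutator_nil h2x h2y (rmorph_commutator_nil tx ty (comm_nil x y)).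
rewrite (jordan_commutator_pow _ (jordan_pair_wshift n half)) => /eqP.
rewrite scaler_eq0 expf_eq0 invr_eq0 (negPf two_neq0) andbF /= => J0.
have pl : (p ^ l' <= (p ^ l).+1)%N.
  apply: leq_trans m_le; rewrite leqNgt -nE; apply/negP=> lt.
  move/eqP/matrixP/(_ ord0 (Ordinal lt)): J0; rewrite wshift1_pow_entry mxE.
  by move/eqP; rewrite oner_eq0.
rewrite leqNgt; apply/negP=> ll'.
have : (p ^ l.+1 <= (p ^ l).+1)%N by apply: leq_trans pl; rewrite leq_exp2l.
have : (0 < p ^ l)%N by rewrite expn_gt0 p_gt0.
by rewrite expnS; nia.
Qed.

End Uniqueness.

(** * Braiding and primitive elements in a pre-Nichols algebra of V *)

Section Morphisms.
Variable K : fieldType.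

(** The structure of the quotient is defined by representatives, but g turns
    each of its operations into the corresponding operation of B evaluated at
    f; this takes the place of a proof that the ideal is a Hopf ideal. *)
Lemma quot_pn_morphism (V : lmodType K) (A B : algType K) (RA : preNichols V A)
    (RB : braidedHopf B) (S : A -> Prop) (S_proper : ~ ideal S 1)
    (f : {lrmorphism A -> B}) (g : {lrmorphism aquot S_proper -> B}) :
  linear (braid RB) -> (forall a, g (api S_proper a) = f a) ->
  is_braided_hopf_morphism RA RB f ->
  is_braided_hopf_morphism (quot_pn RA S_proper) RB g.
Proof.
move=> braid_lin gE [f_comul f_counit f_braid].
have pi_lin : linear (api S_proper) by exact: linearP.
have g_lin : linear g by exact: linearP.
have ggE t : tmap g g (tmap (api S_proper) (api S_proper) t) = tmap f f t.
  by rewrite tmap_comp //; apply: eq_tlift => u v /=; rewrite !gE.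
split=> [q|q|t].
- by rewrite -{1}[q]areprK gE f_comul -ggE.
- by rewrite -{1}[q]areprK gE f_counit.
- rewrite (lin_tlift _ _ (tmap_linear g_lin g_lin)).
  rewrite /tmap (lin_tlift _ _ braid_lin); apply: eq_tlift => q r.
  rewrite -[RHS]/(tmap g g _) ggE -f_braid tmap_tens; try exact: linearP.
  by rewrite -!gE !areprK.
Qed.

Lemma braided_hopf_iso_inv (A B : algType K) (HA : braidedHopf A)
    (HB : braidedHopf B) (f : {lrmorphism A -> B}) :
  is_braided_hopf_morphism HA HB f -> bijective f -> braided_hopf_iso HB HA.
Proof.
move=> [f_comul f_counit f_braid] [g fK gK].
have g_lin : linear g by exact: can2_linear fK gK.
have g_mon : monoid_morphism g by exact: can2_monoid_morphism fK gK.
pose gL := GRing.isLinear.Build K _ _ _ g g_lin.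
pose gM := GRing.isMonoidMorphism.Build _ _ g g_mon.
pose g' : {lrmorphism B -> A} := HB.pack g gL gM.
have f_lin : linear f by exact: linearP.
have gfK t : tmap g g (tmap f f t) = t.
  by rewrite tmap_comp // tmap_id.
have fgK t : tmap f f (tmap g g t) = t.
  by rewrite tmap_comp // tmap_id.
exists g'; last by exists f.
split=> [b|b|t] /=.
- by rewrite -{2}[b]gK f_comul gfK.
- by rewrite -{2}[b]gK f_counit.
- by rewrite -{2}[t]fgK f_braid gfK.
Qed.

End Morphisms.

Section PreNichols.
Variables (K : fieldType) (R : algType K) (RN : preNichols (Vsp K) R).
Hypothesis RN_pn : is_pre_nichols (@cV K) RN.
Local Notation c := (braid RN).
Local Notation inj := (pn_inj RN).

Let RN_bh := pn_braided_hopf RN_pn.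
Let c_lin : linear c := braid_linear (bh_braiding RN_bh).
Let D_lin : linear (comul RN) := bh_comul_linear RN_bh.
Let inj_lin : linear inj := pn_inj_linear RN_pn.

Lemma braid_mull (a b d d' d'' : R) : c (b ⊗ d) = d' ⊗ b ->
  c (a ⊗ d') = d'' ⊗ a -> c ((a * b) ⊗ d) = d'' ⊗ (a * b).
Proof.
move=> cbd cad; have ml := @tmul_linear K R.
have := bh_braidMl RN_bh (a ⊗ b ⊗ d).
rewrite tmap_tens // tmul_tens => ->.
rewrite /braid2 tassoc_tens tmap_tens // cbd tassocV_tens.
by rewrite /braid1 tmap_tens // cad tassoc_tens tmap_tens // tmul_tens.
Qed.

Lemma braid_mulr (a b d b' d' : R) : c (a ⊗ b) = b' ⊗ a ->
  c (a ⊗ d) = d' ⊗ a -> c (a ⊗ (b * d)) = (b' * d') ⊗ a.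
Proof.
move=> cab cad; have ml := @tmul_linear K R.
have := bh_braidMr RN_bh (a ⊗ b ⊗ d).
rewrite tassoc_tens tmap_tens // tmul_tens => ->.
rewrite /braid1 tmap_tens // cab.
rewrite /braid2 tassoc_tens tmap_tens // cad tassocV_tens.
by rewrite tmap_tens // tmul_tens.
Qed.

(** The relation u' = g u, for the automorphism g induced on R by the group
    generator.  As a relation it is available before g is known to descend from
    the tensor algebra to R, and it is closed under all algebra operations. *)
Definition twisted_by_g (u u' : R) : Prop :=
  forall v, c (inj v ⊗ u) = u' ⊗ inj v.

Lemma twisted1 : twisted_by_g 1 1.
Proof. by move=> v; apply: bh_braid1r RN_bh _. Qed.

Lemma twistedM u u' w w' : twisted_by_g u u' -> twisted_by_g w w' ->
  twisted_by_g (u * w) (u' * w').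
Proof. by move=> uu' ww' v; apply: braid_mulr. Qed.

Lemma twistedD u u' w w' : twisted_by_g u u' -> twisted_by_g w w' ->
  twisted_by_g (u + w) (u' + w').
Proof.
by move=> uu' ww' v; rewrite tensDr (linD c_lin) uu' ww' tensDl.
Qed.

Lemma twistedZ a u u' : twisted_by_g u u' -> twisted_by_g (a *: u) (a *: u').
Proof. by move=> uu' v; rewrite tensZr (linZ c_lin) uu' tensZl. Qed.

Lemma twistedX u u' n : twisted_by_g u u' -> twisted_by_g (u ^+ n) (u' ^+ n).
Proof.
move=> uu'; elim: n => [|n IHn]; first exact: twisted1.
by rewrite !exprS; apply: twistedM.
Qed.

Lemma twisted_inj w : twisted_by_g (inj w) (inj (gV w)).
Proof.
move=> v; have := pn_inj_braid RN_pn (v ⊗ w).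
by rewrite cV_tens !tmap_tens.
Qed.

Lemma gr1_inj v : pn_gr RN 1 (inj v).
Proof. by apply/(pn_inj_image RN_pn); exists v. Qed.

Lemma counit_inj v : counit RN (inj v) = 0.
Proof. exact (gr_counit (pn_graded RN_pn) (gr1_inj v)). Qed.

(** Degree one elements are primitive: by grading and connectedness their
    coproduct is of the form u ⊗ 1 + 1 ⊗ w, and the counit axioms identify u
    and w. *)
Lemma comul_inj v : comul RN (inj v) = inj v ⊗ 1 + 1 ⊗ inj v.
Proof.
have RNg := pn_graded RN_pn.
have e_lin := bh_counit_linear RN_bh.
have [u [w [gu gw e]]] : exists u w, [/\ pn_gr RN 1 u, pn_gr RN 1 w &
    comul RN (inj v) = u ⊗ 1 + 1 ⊗ w].
  have gr10 := (gr_subspace RNg 1).1; have gr1P := (gr_subspace RNg 1).2.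
  elim: (gr_comul RNg (gr1_inj v)) => [_ [i [j [u [w [ij gu gw ->]]]]]|
    |s t _ [u [w [gu gw ->]]] _ [u' [w' [gu' gw' ->]]]|a s _ [u [w [gu gw ->]]]].
  - case: i j ij gu gw => [|[|i]] [|[|j]] // _ gu gw.
      have [k ->] := gr_connected RNg gu; exists 0, (k *: w); split=> //.
        by rewrite -[_ *: _]addr0; apply: gr1P.
      by rewrite tens0l add0r tensZl tensZr.
    have [k ->] := gr_connected RNg gw; exists (k *: u), 0; split=> //.
      by rewrite -[_ *: _]addr0; apply: gr1P.
    by rewrite tensZl tensZr (lin0 ((tens_bilin R R).1 1)) addr0.
  - exists 0, 0; split=> //.
    by rewrite tens0l (lin0 ((tens_bilin R R).1 1)) addr0.
  - exists (u + u'), (w + w'); split.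
    + by rewrite -[u]scale1r; apply: gr1P.
    + by rewrite -[w]scale1r; apply: gr1P.
    + by rewrite tensDl tensDr addrACA.
  - exists (a *: u), (a *: w); split.
    + by rewrite -[_ *: _]addr0; apply: gr1P.
    + by rewrite -[_ *: _]addr0; apply: gr1P.
    + by rewrite tensZl tensZr -scalerDr.
have bl : bilin (fun u v : R => counit RN u *: v).
  split=> [x k y z|x k y z]; first by rewrite scalerDr !scalerA mulrC.
  by rewrite /= e_lin scalerDl scalerA.
have br : bilin (fun u v : R => counit RN v *: u).
  split=> [x k y z|x k y z]; first by rewrite e_lin scalerDl scalerA.
  by rewrite /= scalerDr !scalerA mulrC.
have ew : w = inj v.
  have := bh_counitl RN_bh (inj v); rewrite e (linD (tlift_linear bl)).
  rewrite !tlift_tens // (gr_counit RNg gu) scale0r add0r.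
  by rewrite (bh_counit1 RN_bh) scale1r.
have eu : u = inj v.
  have := bh_counitr RN_bh (inj v); rewrite e (linD (tlift_linear br)).
  rewrite !tlift_tens // (gr_counit RNg gw) scale0r addr0.
  by rewrite (bh_counit1 RN_bh) scale1r.
by rewrite e eu ew.
Qed.

Lemma bmul_inj v u u' w : twisted_by_g u u' ->
  bmul c (inj v ⊗ 1 + 1 ⊗ inj v) (u ⊗ w) =
  (inj v * u) ⊗ w + u' ⊗ (inj v * w).
Proof.
move=> uu'; rewrite (linD (bmul_linearl c_lin (u ⊗ w))).
rewrite (bmul_tens c_lin _ _ (bh_braid1l RN_bh u)).
by rewrite (bmul_tens c_lin _ _ (uu' v)) !mul1r.
Qed.

End PreNichols.

(** * Algebra maps from G(k, l) that are morphisms of braided Hopf algebras *)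

Lemma coord_sum_linear (K : fieldType) (W : lmodType K) n (e : 'I_n -> W) :
  linear (fun v : 'rV[K]_n => \sum_(i < n) v ord0 i *: e i).
Proof.
move=> a v w; rewrite scaler_sumr -big_split; apply: eq_bigr => i _ /=.
by rewrite !mxE scalerDl scalerA.
Qed.

Section TensorAlgebraStructure.
Variable K : fieldType.
Local Notation TV := (TV K).

Lemma TV_inj_linear : linear (@TV_inj K).
Proof. exact: (coord_sum_linear (fun i => letter K i)). Qed.

Let TV_braid_bilin : bilin (fun u v : TV => flift (fun w : {fmonom 'I_2} =>
  iter (fdeg w) (@TV_act K) v ⊗ word K w) u).
Proof.
split=> [u k v v'|v]; last exact: flift_is_linear.
rewrite /flift scaler_sumr -big_split; apply: eq_bigr => w _ /=.
have itl m : linear (iter m (@TV_act K)).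
  elim: m => [|m IHm] // a x y; rewrite !iterS IHm; exact: flift_is_linear.
by rewrite itl tensDl tensZl scalerDr !scalerA mulrC.
Qed.

Lemma TV_braid_linear : linear (@TV_braid K).
Proof. exact: tlift_linear TV_braid_bilin. Qed.

Lemma TV_braid_word w (v : TV) :
  TV_braid (word K w ⊗ v) = iter (fdeg w) (@TV_act K) v ⊗ word K w.
Proof. exact: etrans (tlift_tens TV_braid_bilin _ _) (fliftU _ _). Qed.

Lemma TV_comul1 : TV_comul (word K (FMonom [::])) = 1 ⊗ 1.
Proof. exact: fliftU. Qed.

Lemma TV_comul_cons i s : TV_comul (word K (FMonom (i :: s))) =
  bmul (@TV_braid K) (letter K i ⊗ 1 + 1 ⊗ letter K i)
    (TV_comul (word K (FMonom s))).
Proof. by rewrite /TV_comul !fliftU /= TV_inj_delta. Qed.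

End TensorAlgebraStructure.

Lemma subalg_twisted (K : fieldType) (R : algType K) (RN : preNichols (Vsp K) R)
    (RN_pn : is_pre_nichols (@cV K) RN) (A : algType K)
    (f f' : {lrmorphism A -> R}) (S : A -> Prop) a :
  (forall s, S s -> twisted_by_g RN (f s) (f' s)) ->
  subalg S a -> twisted_by_g RN (f a) (f' a).
Proof.
move=> ST; elim=> [//||u v _ Tu _ Tv|k u _ Tu|u v _ Tu _ Tv].
- by rewrite !rmorph1; apply: twisted1.
- by rewrite !rmorphD; apply: twistedD.
- by rewrite !linearZ; apply: twistedZ.
- by rewrite !rmorphM; apply: twistedM.
Qed.

Lemma eq_on_subalg (K : fieldType) (A B : algType K) (f f' : {lrmorphism A -> B})
    (S : A -> Prop) a :
  (forall s, S s -> f s = f' s) -> subalg S a -> f a = f' a.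
Proof.
move=> ST; elim=> [//||u v _ Tu _ Tv|k u _ Tu|u v _ Tu _ Tv].
- by rewrite !rmorph1.
- by rewrite !rmorphD /= Tu Tv.
- by rewrite !linearZ /= Tu.
- by rewrite !rmorphM /= Tu Tv.
Qed.

Section ShearedEvaluation.
Variables (K : fieldType) (R : algType K) (RN : preNichols (Vsp K) R).
Hypothesis RN_pn : is_pre_nichols (@cV K) RN.
Local Notation TV := (TV K).
Local Notation c := (braid RN).
Local Notation inj := (pn_inj RN).
Variable a : K.

Let RN_bh := pn_braided_hopf RN_pn.
Let c_lin : linear c := braid_linear (bh_braiding RN_bh).
Let D_lin : linear (comul RN) := bh_comul_linear RN_bh.
Let inj_lin : linear inj := pn_inj_linear RN_pn.

(** The images of the basis under an automorphism of V that commutes with the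
    action of g, hence with the braiding.  The parameter a is the freedom used
    to make a power of the image of y vanish. *)
Definition shear (i : 'I_2) : Vsp K :=
  if i == ord0 then xV K else yV K + a *: xV K.

Definition sheared : {lrmorphism TV -> R} := TV_eval (fun i => inj (shear i)).

Lemma sheared_letter i : sheared (letter K i) = inj (shear i).
Proof. exact: TV_eval_letter. Qed.

Let sheared_lin : linear sheared. Proof. exact: linearP. Qed.

Lemma gV_linear : linear (@gV K).
Proof.
by move=> k u v; rewrite /gV !mxE scalerDr scalerDl scalerA addrACA.
Qed.

Lemma sheared_gV i :
  sheared (TV_inj (gV (delta_mx ord0 i : Vsp K))) = inj (gV (shear i)).
Proof.
have PI_lin : linear (fun v => sheared (TV_inj v)).
  exact: comp_linear (@TV_inj_linear K) sheared_lin.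
have Pinj j : sheared (TV_inj (delta_mx ord0 j : Vsp K)) = inj (shear j).
  by rewrite TV_inj_delta sheared_letter.
have [->|->] := ord2P i.
  rewrite [gV (delta_mx _ _)]gV_x; exact: Pinj.
rewrite [gV (delta_mx _ _)]gV_y; apply: etrans (linD PI_lin _ _) _.
apply: etrans (congr2 +%R (Pinj ord_max) (Pinj ord0)) _.
rewrite -(linD inj_lin) /shear /= (linD gV_linear) (linZ gV_linear) gV_x gV_y.
by rewrite addrAC.
Qed.

Lemma sheared_twisted u : twisted_by_g RN (sheared u) (sheared (TV_act u)).
Proof.
pose act : {lrmorphism TV -> TV} :=
  TV_eval (fun i => TV_inj (gV (delta_mx ord0 i : Vsp K))).
pose T : {lrmorphism TV -> R} := sheared \o act.
apply: (subalg_twisted RN_pn (f := sheared) (f' := T) _ (TV_gen u)) => _ [i ->].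
have -> : T (letter K i) = inj (gV (shear i)).
  exact: etrans (congr1 sheared (TV_eval_letter _ i)) (sheared_gV i).
rewrite sheared_letter; exact: twisted_inj.
Qed.

Lemma sheared_nil : sheared (word K (FMonom [::])) = 1.
Proof. by rewrite word_seq big_nil rmorph1. Qed.

Lemma sheared_letterM i u : sheared (letter K i * u) = inj (shear i) * sheared u.
Proof.
exact: etrans (rmorphM sheared _ _) (congr1 (fun z => z * _) (sheared_letter i)).
Qed.

Lemma sheared_cons i s :
  sheared (word K (FMonom (i :: s))) = inj (shear i) * sheared (word K (FMonom s)).
Proof. rewrite !word_seq big_cons; exact: sheared_letterM. Qed.

Lemma sheared_iter_twisted s v :
  c (sheared (word K (FMonom s)) ⊗ sheared v) =
  sheared (iter (size s) (@TV_act K) v) ⊗ sheared (word K (FMonom s)).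
Proof.
elim: s => [|i s IHs].
  by rewrite sheared_nil; apply: bh_braid1l RN_bh _.
rewrite sheared_cons iterS; apply: (braid_mull RN_pn IHs); exact: sheared_twisted.
Qed.

Lemma sheared_braid t : c (tmap sheared sheared t) = tmap sheared sheared (TV_braid t).
Proof.
have bl := @TV_braid_linear K.
pattern t; apply: (@eq_on_tens _ _ _ _ (c \o tmap sheared sheared)
  (tmap sheared sheared \o @TV_braid K)).
- apply: comp_linear => //; exact: tmap_linear.
- apply: comp_linear => //; exact: tmap_linear.
move=> u v; rewrite /= tmap_tens //.
pattern u; apply: TV_ind => [s||k u1 u2 IH1 IH2].
- by rewrite TV_braid_word tmap_tens // sheared_iter_twisted.
- rewrite (lin0 sheared_lin) !tens0l (lin0 c_lin) (lin0 bl).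
  by rewrite (lin0 (tmap_linear sheared_lin sheared_lin)).
- rewrite sheared_lin !tensDl !tensZl c_lin IH1 IH2.
  by rewrite bl (tmap_linear sheared_lin sheared_lin).
Qed.

Lemma sheared_bmul i t :
  tmap sheared sheared (bmul (@TV_braid K) (letter K i ⊗ 1 + 1 ⊗ letter K i) t) =
  bmul c (inj (shear i) ⊗ 1 + 1 ⊗ inj (shear i)) (tmap sheared sheared t).
Proof.
have bl := @TV_braid_linear K.
have tl := tmap_linear sheared_lin sheared_lin.
pattern t; apply: (@eq_on_tens _ _ _ _
  (tmap sheared sheared \o bmul (@TV_braid K) (letter K i ⊗ 1 + 1 ⊗ letter K i))
  (bmul c (inj (shear i) ⊗ 1 + 1 ⊗ inj (shear i)) \o tmap sheared sheared)).
- by apply: comp_linear => //; apply: bmul_linearr.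
- by apply: comp_linear => //; apply: bmul_linearr.
move=> u v; rewrite /= tmap_tens // (bmul_inj RN_pn _ _ (sheared_twisted u)).
rewrite (linD (bmul_linearl bl (u ⊗ v))).
have c1 : TV_braid (1 ⊗ u) = u ⊗ 1.
  have -> : (1 : TV) = word K (FMonom [::]) by rewrite word_seq big_nil.
  exact: TV_braid_word.
have ci : TV_braid (letter K i ⊗ u) = TV_act u ⊗ letter K i.
  rewrite /letter TV_braid_word; congr (_ ⊗ _).
  by rewrite fdegU.
rewrite (bmul_tens bl _ _ c1) (bmul_tens bl _ _ ci) !mul1r.
apply: etrans (linD tl _ _) _.
apply: etrans (congr2 +%R (tmap_tens _ _ sheared_lin sheared_lin)
  (tmap_tens _ _ sheared_lin sheared_lin)) _.
exact: congr2 (congr1 (fun z => z ⊗ _) (sheared_letterM i u))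
  (congr1 (tens _) (sheared_letterM i v)).
Qed.

Lemma sheared_comul u : comul RN (sheared u) = tmap sheared sheared (TV_comul u).
Proof.
have tl := tmap_linear sheared_lin sheared_lin.
have dl : linear (@TV_comul K) by exact: flift_is_linear.
pattern u; apply: TV_ind => [s||k u1 u2 IH1 IH2].
- elim: s => [|i s IHs].
    rewrite TV_comul1 tmap_tens // (rmorph1 sheared) sheared_nil.
    exact: bh_comul1 RN_bh.
  rewrite TV_comul_cons sheared_bmul -IHs sheared_cons.
  by rewrite (bh_comulM RN_bh) (comul_inj RN_pn).
- by rewrite (lin0 sheared_lin) (lin0 D_lin) (lin0 dl) (lin0 tl).
- by rewrite sheared_lin D_lin IH1 IH2 dl tl.
Qed.

Lemma sheared_counit u : counit RN (sheared u) = TV_counit u.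
Proof.
have el := bh_counit_linear RN_bh; have tl := @TV_counit_linear K.
elim: (TV_gen u) => [_ [i ->]||v w _ IHv _ IHw|k v _ IHv|v w _ IHv _ IHw].
- by rewrite sheared_letter (counit_inj RN_pn) -TV_inj_delta TV_counit_inj.
- by rewrite rmorph1 (bh_counit1 RN_bh) TV_counit1.
- by rewrite (linD sheared_lin) (linD el) (linD tl) IHv IHw.
- by rewrite (linZ sheared_lin) (linZ el) (linZ tl) IHv.
- by rewrite rmorphM (bh_counitM RN_bh) TV_counitM IHv IHw.
Qed.

(** All structure maps of T(V) are determined by their values on generators,
    where they agree with those of R because shears preserve the braiding. *)
Lemma sheared_morphism : is_braided_hopf_morphism (TV_pn K) RN sheared.
Proof.
split=> [u|u|t]; [exact: sheared_comul | exact: sheared_counit | exact: sheared_braid].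
Qed.

Section FromG.
Variables (p : nat) (charKp : p \in [pchar K]) (k l : nat).
Variable g : {lrmorphism Defs.G charKp k l -> R}.
Hypothesis gX : g (gx charKp k l) = inj (xV K).
Hypothesis gY : g (gy charKp k l) = inj (yV K) + a *: inj (xV K).

Lemma G_morphism : is_braided_hopf_morphism (G_pn charKp k l) RN g.
Proof.
pose f : {lrmorphism jordan K -> R} := g \o api (@G_proper K p charKp k l).
apply: (@quot_pn_morphism _ _ _ _ _ _ _ _ f g c_lin) => //.
apply: (@quot_pn_morphism _ _ _ _ _ _ _ _ sheared f c_lin _ sheared_morphism).
move=> u; pose f' : {lrmorphism TV -> R} := f \o api (@jordan_proper K).
apply: (eq_on_subalg (f := f') (f' := sheared) _ (TV_gen u)) => _ [i ->].
rewrite sheared_letter -TV_inj_delta; have [->|->] := ord2P i.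
  exact: gX.
rewrite /shear /= (linD inj_lin) (linZ inj_lin); exact: gY.
Qed.

End FromG.
End ShearedEvaluation.

(** * The coproduct of a monomial *)

Lemma pascal_sum (V : zmodType) (A B P : nat -> V) n :
  A 0 = P 0 -> A n.+1 = 0 -> (forall i, (i <= n)%N -> A i.+1 + B i = P i.+1) ->
  \sum_(i < n.+1) A i + \sum_(i < n.+1) B i = \sum_(i < n.+2) P i.
Proof.
move=> A0 An AB; rewrite [in RHS]big_ord_recl -A0.
have -> : \sum_(i < n.+1) A i = \sum_(i < n.+2) A i.
  by rewrite [RHS]big_ord_recr /= An addr0.
rewrite [X in X + _ = _]big_ord_recl -addrA -big_split /=; congr (_ + _).
by apply: eq_bigr => i _; rewrite /bump /= AB // -ltnS.
Qed.

Section CoproductStep.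
Variables (K : fieldType) (A : algType K) (h : K) (X Y : A).
Hypothesis XY : jordan_pair h X Y.
Hypothesis hh : h + h = 1.

(** The Pascal recursion for P_(b, i) = binom(b, i) (Y + i h X)^(b - i), the left
    factor of Y^i in the coproduct of Y^b: the two terms come from Y ⊗ 1 and
    from 1 ⊗ Y, the latter applying g to the left factor.  In terms of
    Q = Y + (i + 1) h X one has Y = Q - (i + 1) h X, and the twisted factor is
    Q + h X, precisely because 2 h = 1. *)
Lemma jordan_coproduct_step b i : (i <= b)%N ->
  'C(b, i.+1)%:R *: (Y * (Y + (h * i.+1%:R) *: X) ^+ (b - i.+1)) +
    'C(b, i)%:R *: (Y + (h * i%:R + 1) *: X) ^+ (b - i) =
  'C(b.+1, i.+1)%:R *: (Y + (h * i.+1%:R) *: X) ^+ (b.+1 - i.+1).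
Proof.
move=> ib; set e := h * i.+1%:R; pose Q := Y + e *: X; rewrite -/Q.
have -> : Y + (h * i%:R + 1) *: X = Q + h *: X.
  rewrite /Q -addrA -scalerDl; congr (_ + _ *: _).
  by rewrite /e -[i.+1%:R]natr1 mulrDr mulr1 -addrA hh.
have XQ : jordan_pair h X Q by apply: jordan_shift.
have eY : Y = Q - e *: X by rewrite addrK.
rewrite (jordan_expand_h XQ) subSS binS natrD scalerDl scalerDr.
move: ib; rewrite leq_eqVlt => /orP[/eqP <-|ib].
  by rewrite subnn bin_small // !scale0r !add0r !expr0 mulr0 !scale0r ?scaler0 ?addr0.
rewrite -(subnSK ib) /= {1}eY mulrBl -exprS -scalerAl scalerBr !scalerA addrACA.
rewrite -[RHS]addr0; congr (_ + _).
rewrite -scaleNr -scalerDl (_ : _ + _ = 0) ?scale0r // /e addrC.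
apply/eqP; rewrite subr_eq0; apply/eqP.
by rewrite !(mulrCA _ h) (subnSK ib) -!natrM mulnC -mul_bin_left mulnC.
Qed.

End CoproductStep.

Section Coproduct.
Variables (K : fieldType) (R : algType K) (RN : preNichols (Vsp K) R).
Hypothesis RN_pn : is_pre_nichols (@cV K) RN.
Variable h : K.
Hypothesis hh : h + h = 1.
Local Notation X := (pn_inj RN (xV K)).
Local Notation Y := (pn_inj RN (yV K)).
Hypothesis XY : jordan_pair h X Y.

Let RN_bh := pn_braided_hopf RN_pn.
Let c_lin : linear (braid RN) := braid_linear (bh_braiding RN_bh).
Let D_lin : linear (comul RN) := bh_comul_linear RN_bh.

Lemma twisted_monomial s c t :
  twisted_by_g RN (X ^+ s * (Y + c *: X) ^+ t) (X ^+ s * (Y + (c + 1) *: X) ^+ t).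
Proof.
have tX : twisted_by_g RN X X by have := twisted_inj RN_pn (xV K); rewrite gV_x.
have tY : twisted_by_g RN Y (Y + X).
  have := twisted_inj RN_pn (yV K); rewrite gV_y.
  by rewrite (linD (pn_inj_linear RN_pn)).
apply: twistedM => //; apply: twistedX => //.
have -> : Y + (c + 1) *: X = (Y + X) + c *: X.
  by rewrite scalerDl scale1r addrAC addrA.
by apply: twistedD => //; apply: twistedZ.
Qed.

Lemma comul_injM v (I : Type) (r : seq I) (u u' w : I -> R) (k : I -> K) z :
  (forall i, twisted_by_g RN (u i) (u' i)) ->
  comul RN z = \sum_(i <- r) k i *: (u i ⊗ w i) ->
  comul RN (pn_inj RN v * z) =
  \sum_(i <- r) k i *: ((pn_inj RN v * u i) ⊗ w i) +
  \sum_(i <- r) k i *: (u' i ⊗ (pn_inj RN v * w i)).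
Proof.
move=> uu' ez; rewrite (bh_comulM RN_bh) (comul_inj RN_pn) ez.
rewrite (lin_sum (bmul_linearr c_lin _)) -big_split; apply: eq_bigr => i _ /=.
by rewrite (linZ (bmul_linearr c_lin _)) (bmul_inj RN_pn _ _ (uu' i)) scalerDr.
Qed.

Lemma comul_Yn b : comul RN (Y ^+ b) =
  \sum_(i < b.+1) 'C(b, i)%:R *: ((Y + (h * i%:R) *: X) ^+ (b - i) ⊗ Y ^+ i).
Proof.
elim: b => [|b IHb].
  by rewrite big_ord1 bin0 scale1r !expr0; exact: bh_comul1 RN_bh.
rewrite exprS.
rewrite (comul_injM (yV K)
  (u' := fun i : 'I_b.+1 => (Y + (h * i%:R + 1) *: X) ^+ (b - i)) _ IHb); last first.
  move=> i; have := twisted_monomial 0 (h * i%:R) (b - i).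
  by rewrite expr0 !mul1r.
apply: (@pascal_sum _
  (fun i => 'C(b, i)%:R *: ((Y * (Y + (h * i%:R) *: X) ^+ (b - i)) ⊗ Y ^+ i))
  (fun i => 'C(b, i)%:R *: ((Y + (h * i%:R + 1) *: X) ^+ (b - i) ⊗ (Y * Y ^+ i)))
  (fun i => 'C(b.+1, i)%:R *: ((Y + (h * i%:R) *: X) ^+ (b.+1 - i) ⊗ Y ^+ i))).
- by rewrite !bin0 mulr0 scale0r addr0 !subn0 -exprS.
- by rewrite bin_small // scale0r.
move=> i ib; rewrite -exprS -!tensZl -tensDl.
by rewrite (jordan_coproduct_step XY hh).
Qed.

(** Multiplying by X on the left contributes X ⊗ 1, and 1 ⊗ X together with one
    more application of g to the left factor; this replaces Y by Y + X and
    accounts for the summand j in the coefficient j + h i. *)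
Lemma comul_XaYb a b : comul RN (X ^+ a * Y ^+ b) =
  \sum_(j < a.+1) \sum_(i < b.+1) ('C(a, j)%:R * 'C(b, i)%:R) *:
    ((X ^+ (a - j) * (Y + (j%:R + h * i%:R) *: X) ^+ (b - i)) ⊗ (X ^+ j * Y ^+ i)).
Proof.
elim: a => [|a IHa].
  rewrite expr0 mul1r comul_Yn big_ord1; apply: eq_bigr => i _.
  by rewrite bin0 !mul1r add0r.
rewrite exprS -mulrA; move: IHa; rewrite pair_bigA => IHa.
rewrite (comul_injM (xV K) (u' := fun ji : 'I_a.+1 * 'I_b.+1 =>
  X ^+ (a - ji.1) * (Y + (ji.1%:R + h * ji.2%:R + 1) *: X) ^+ (b - ji.2)) _ IHa);
  last by move=> ji; apply: twisted_monomial.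
rewrite -(pair_bigA _ (fun (j : 'I_a.+1) (i : 'I_b.+1) =>
  ('C(a, j)%:R * 'C(b, i)%:R) *: ((X * (X ^+ (a - j) *
    (Y + (j%:R + h * i%:R) *: X) ^+ (b - i))) ⊗ (X ^+ j * Y ^+ i)))) /=.
rewrite -(pair_bigA _ (fun (j : 'I_a.+1) (i : 'I_b.+1) =>
  ('C(a, j)%:R * 'C(b, i)%:R) *: ((X ^+ (a - j) *
    (Y + (j%:R + h * i%:R + 1) *: X) ^+ (b - i)) ⊗ (X * (X ^+ j * Y ^+ i))))) /=.
pose F j := \sum_(i < b.+1) 'C(b, i)%:R *:
  ((X ^+ (a.+1 - j) * (Y + (j%:R + h * i%:R) *: X) ^+ (b - i)) ⊗ (X ^+ j * Y ^+ i)).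
transitivity (\sum_(j < a.+1) 'C(a, j)%:R *: F j +
              \sum_(j < a.+1) 'C(a, j)%:R *: F j.+1).
  congr (_ + _); apply: eq_bigr => j _; rewrite scaler_sumr; apply: eq_bigr => i _.
    by rewrite scalerA mulrA -exprS -subSn // -ltnS.
  by rewrite scalerA mulrA -exprS subSS -[j.+1%:R]natr1 addrAC.
rewrite (@pascal_sum _ (fun j => 'C(a, j)%:R *: F j)
  (fun j => 'C(a, j)%:R *: F j.+1) (fun j => 'C(a.+1, j)%:R *: F j)).
- apply: eq_bigr => j _; rewrite scaler_sumr; apply: eq_bigr => i _.
  by rewrite scalerA.
- by rewrite !bin0.
- by rewrite bin_small // scale0r.
- by move=> j _; rewrite -scalerDl -natrD -binS.
Qed.

(** The skew differential operator (id ⊗ phi) Delta. *)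
Definition contract (phi : R -> K) (r : R) : R :=
  tlift (fun u v => phi v *: u) (comul RN r).

Variable phi : R -> K.
Hypothesis phi_lin : linear (phi : R -> K^o).

Let contract_bilin : bilin (fun u v : R => phi v *: u).
Proof.
split=> [x k y z|x k y z]; first by rewrite phi_lin scalerDl scalerA.
by rewrite /= scalerDr !scalerA mulrC.
Qed.

Lemma contract_linear : linear (contract phi).
Proof. exact: comp_linear D_lin (tlift_linear contract_bilin). Qed.

Lemma contract_XaYb a b : contract phi (X ^+ a * Y ^+ b) =
  \sum_(j < a.+1) \sum_(i < b.+1)
    ('C(a, j)%:R * 'C(b, i)%:R * phi (X ^+ j * Y ^+ i)) *:
    (X ^+ (a - j) * (Y + (j%:R + h * i%:R) *: X) ^+ (b - i)).
Proof.
rewrite /contract comul_XaYb (lin_sum (tlift_linear contract_bilin)).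
apply: eq_bigr => j _; rewrite (lin_sum (tlift_linear contract_bilin)).
apply: eq_bigr => i _; rewrite (linZ (tlift_linear contract_bilin)).
by rewrite tlift_tens // scalerA.
Qed.

End Coproduct.

(** * A basis of monomials *)

Section VectorSpaces.
Variables (K : fieldType) (V : vectType K).

Lemma sum_lineP (I : finType) (P : pred I) (F : I -> V) u :
  u \in (\sum_(i | P i) <[F i]>)%VS ->
  exists c : I -> K, u = \sum_(i | P i) c i *: F i.
Proof.
case/memv_sumP=> v vF ->.
have /fin_all_exists[c vc] i : exists k, P i -> v i = k *: F i.
  have [Pi|_] := boolP (P i); last by exists 0.
  by have /vlineP[k vk] := vF i Pi; exists k.
by exists c; apply: eq_bigr => i Pi; apply: vc.
Qed.

Lemma mem_sum_line (I : finType) (P : pred I) (F : I -> V) i :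
  P i -> F i \in (\sum_(i | P i) <[F i]>)%VS.
Proof. by move=> Pi; rewrite memvE; apply: (sumv_sup i). Qed.

Lemma separating_functional (W : {vspace V}) v : v \notin W ->
  exists phi : V -> K, [/\ linear (phi : V -> K^o), phi v = 1 &
    forall w, w \in W -> phi w = 0].
Proof.
move=> vW; pose b := [tuple of v :: vbasis W].
have fb : free b.
  by rewrite /= free_cons (span_basis (vbasisP W)) vW (basis_free (vbasisP W)).
exists (coord b ord0); split.
- exact: linearP.
- by have := coord_free ord0 ord0 fb; rewrite eqxx.
move=> w /coord_vbasis ->; rewrite linear_sum big1 // => i _.
rewrite linearZ /=; have := coord_free (lift ord0 i) ord0 fb.
by rewrite /= => ->; rewrite mulr0.
Qed.

End VectorSpaces.

Section PBW.
Variables (K : fieldType) (R : falgType K) (RN : preNichols (Vsp K) R).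
Hypothesis RN_pn : is_pre_nichols (@cV K) RN.
Variable h : K.
Hypothesis hh : h + h = 1.
Local Notation X := (pn_inj RN (xV K)).
Local Notation Y := (pn_inj RN (yV K)).
Hypothesis XY : jordan_pair h X Y.

Let RNg := pn_graded RN_pn.

Lemma gr_monomial a b : pn_gr RN (a + b) (X ^+ a * Y ^+ b).
Proof.
have grX z m : pn_gr RN 1 z -> pn_gr RN m (z ^+ m).
  move=> gz; elim: m => [|m IHm]; first exact: gr_one RNg.
  rewrite exprS -add1n; exact: gr_mul RNg _ _ _ _ gz IHm.
apply: (gr_mul RNg); apply: grX; exact: gr1_inj RN_pn _.
Qed.

Lemma gr_lincomb (I : Type) (r : seq I) (P : pred I) m (c : I -> K) (F : I -> R) :
  (forall i, P i -> pn_gr RN m (F i)) -> pn_gr RN m (\sum_(i <- r | P i) c i *: F i).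
Proof.
have [gr0 grP] := gr_subspace RNg m => gF.
elim/big_ind: _ => [//|u v gu gv|i Pi].
  by rewrite -[u]scale1r; apply: grP.
by rewrite -[_ *: _]addr0; apply: grP => //; apply: gF.
Qed.

Lemma homogeneous_part (I : finType) (deg : I -> nat) (c : I -> K) (F : I -> R) m :
  (forall i, pn_gr RN (deg i) (F i)) -> \sum_i c i *: F i = 0 ->
  \sum_(i | deg i == m) c i *: F i = 0.
Proof.
move=> gF s0; pose n := (\max_i deg i).+1.
have deg_n i : (deg i < n)%N by rewrite ltnS leq_bigmax.
have [m_n|n_m] := ltnP m n; last first.
  by rewrite big_pred0 // => i; apply/ltn_eqF/(leq_trans (deg_n i)).
pose f m := \sum_(i | deg i == m) c i *: F i.
apply: (gr_direct RNg (f := f) (n := n)) => // [j|].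
  by apply: gr_lincomb => i /eqP <-.
rewrite -[RHS]s0 (partition_big (fun i => Ordinal (deg_n i)) xpredT) //=.
Qed.

(** Powers of a homogeneous element of degree one have distinct degrees, so
    only finitely many of them are nonzero in finite dimension. *)
Lemma gr1_nilpotent v : exists2 m, (0 < m)%N & pn_inj RN v ^+ m = 0.
Proof.
set z := pn_inj RN v; pose d := \dim {:R}.
have gz m : pn_gr RN m (z ^+ m).
  elim: m => [|m IHm]; first exact: gr_one RNg.
  rewrite exprS -add1n; exact (gr_mul RNg (gr1_inj RN_pn v) IHm).
have [[m /eqP zm]|z_n0] := altP (@existsP _ (fun m : 'I_d.+1 => z ^+ m == 0)).
  exists m => //; case: (m : nat) zm => // /eqP.
  by rewrite expr0 oner_eq0.
pose s := [tuple z ^+ i | i < d.+1].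
have /eqP s_dim : free s.
  apply/freeP => k sk i.
  have {}sk : \sum_(i < d.+1) k i *: z ^+ i = 0.
    by rewrite -[RHS]sk; apply: eq_bigr => j _; rewrite -tnth_nth tnth_mktuple.
  have := homogeneous_part (deg := fun i : 'I_d.+1 => i) i (fun i => gz i) sk.
  rewrite (bigD1 i) //= big1 => [|j /andP[/eqP/val_inj -> /eqP] //].
  move/eqP; rewrite addr0 scaler_eq0 => /orP[/eqP //|/eqP zi].
  by case/existsP: z_n0; exists i; apply/eqP.
have := dimvS (subvf <<s>>); rewrite s_dim size_tuple -/d ltnn //.
Qed.

(** The homogeneous monomials of degree B that are smaller than Y^B for the
    order by degree in Y. *)
Definition lower_span B : {vspace R} :=
  (\sum_(b < B) <[(X ^+ (B - b) * Y ^+ b)%R]>)%VS.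

Lemma lower_span_monomial s b : (0 < s)%N ->
  X ^+ s * Y ^+ b \in lower_span (s + b).
Proof.
move=> s_gt0; have b_lt : (b < s + b)%N by rewrite -{1}(add0n b) ltn_add2r.
have := @mem_sum_line _ _ _ xpredT
  (fun b' : 'I_(s + b) => X ^+ (s + b - b') * Y ^+ b') (Ordinal b_lt) isT.
by rewrite /= addnK.
Qed.

Lemma lower_span_XY s c b : (0 < s)%N ->
  X ^+ s * (Y + c *: X) ^+ b \in lower_span (s + b).
Proof.
move=> s_gt0; rewrite (jordan_expand XY) mulr_sumr; apply: memv_suml => j _.
rewrite -scalerAr mulrA -exprD memvZ //.
rewrite (_ : s + b = s + j + (b - j))%N; last by rewrite -addnA subnKC // leq_ord.
by apply: lower_span_monomial; rewrite addn_gt0 s_gt0.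
Qed.

(** Replacing Y by Y + c X is triangular for the order by degree in Y. *)
Lemma lower_span_shift c B : (Y + c *: X) ^+ B - Y ^+ B \in lower_span B.
Proof.
rewrite (jordan_expand XY) big_ord_recl /shift_coef big_ord0 bin0 !mul1r scale1r subn0.
rewrite addrC addKr; apply: memv_suml => j _; rewrite memvZ //= /bump add1n.
by have := @lower_span_monomial j.+1 (B - j.+1) isT; rewrite subnKC.
Qed.

Variables (N n : nat).
Hypothesis XN : X ^+ N = 0.
Hypothesis XN_min : forall a, (a < N)%N -> X ^+ a != 0.
Hypothesis n_gt0 : (0 < n)%N.
Hypothesis Yn : Y ^+ n \in lower_span n.
Hypothesis Yn_min : forall b, (0 < b < n)%N -> Y ^+ b \notin lower_span b.

Local Notation I := ('I_N * 'I_n)%type.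
Definition monomial (ab : I) : R := X ^+ ab.1 * Y ^+ ab.2.
Definition mon_degree (ab : I) : nat := ab.1 + ab.2.

Let gr_monomial_ab ab : pn_gr RN (mon_degree ab) (monomial ab).
Proof. exact: gr_monomial. Qed.

Definition indep_in_degree m := forall c : I -> K,
  \sum_(ab | mon_degree ab == m) c ab *: monomial ab = 0 ->
  forall ab, mon_degree ab = m -> c ab = 0.

Lemma dual_functional_in_degree ab0 : indep_in_degree (mon_degree ab0) ->
  exists phi : R -> K, linear (phi : R -> K^o) /\
    forall ab, phi (monomial ab) = (ab == ab0)%:R.
Proof.
move=> ind; pose W := (\sum_(ab : I | ab != ab0) <[monomial ab]>)%VS.
have [|phi [phi_lin phi0 phiW]] := @separating_functional _ _ W (monomial ab0).
  apply/negP=> /sum_lineP[c e].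
  pose c' ab := if ab == ab0 then -1 else c ab.
  have s0 : \sum_ab c' ab *: monomial ab = 0.
    rewrite (bigD1 ab0) //= /c' eqxx scaleN1r e addrC; apply/eqP.
    rewrite subr_eq0; apply/eqP/eq_bigr => ab /negPf; by rewrite /c' => ->.
  have := ind c' (homogeneous_part _ gr_monomial_ab s0) ab0 erefl.
  by rewrite /c' eqxx => /eqP; rewrite oppr_eq0 oner_eq0.
exists phi; split=> // ab; have [->//|ab_ab0] := eqVneq.
by apply: phiW; apply: mem_sum_line.
Qed.

(** When phi is dual to a monomial, only one term of the coproduct survives. *)
Lemma contract_monomial phi a0 i0 : linear (phi : R -> K^o) ->
    (forall ab : I, phi (monomial ab) = (ab == (a0, i0))%:R) ->
  forall ab : I, contract RN phi (monomial ab) =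
    ('C(ab.1, a0)%:R * 'C(ab.2, i0)%:R) *:
    (X ^+ (ab.1 - a0) * (Y + (a0%:R + h * i0%:R) *: X) ^+ (ab.2 - i0)).
Proof.
move=> phi_lin phiE [a b] /=; rewrite /monomial /= (contract_XaYb RN_pn hh XY phi_lin).
have phi_ji (j : 'I_a.+1) (i : 'I_b.+1) :
    phi (X ^+ j * Y ^+ i) = ((j == a0 :> nat) && (i == i0 :> nat))%:R.
  have jN : (j < N)%N by apply: leq_trans (ltn_ord j) (ltn_ord a).
  have iN : (i < n)%N by apply: leq_trans (ltn_ord i) (ltn_ord b).
  by apply: etrans (phiE (Ordinal jN, Ordinal iN)) _; rewrite xpair_eqE -!val_eqE.
have [a0_a|a_a0] := leqP a0 a; last first.
  rewrite (bin_small a_a0) mul0r scale0r big1 // => j _; rewrite big1 // => i _.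
  rewrite phi_ji (_ : _ == _ = false) ?mulr0 ?scale0r //.
  by apply/ltn_eqF/(leq_ltn_trans (leq_ord j)).
have [i0_b|b_i0] := leqP i0 b; last first.
  rewrite (bin_small b_i0) mulr0 scale0r big1 // => j _; rewrite big1 // => i _.
  rewrite phi_ji andbC (_ : _ == _ = false) ?mulr0 ?scale0r //.
  by apply/ltn_eqF/(leq_ltn_trans (leq_ord i)).
rewrite -ltnS in a0_a; rewrite -ltnS in i0_b.
rewrite (bigD1 (Ordinal a0_a)) //= [X in _ + X = _]big1 ?addr0 => [|j ja]; last first.
  rewrite big1 // => i _; rewrite phi_ji.
  by move: ja; rewrite -val_eqE /= => /negPf ->; rewrite mulr0 scale0r.
rewrite (bigD1 (Ordinal i0_b)) //= big1 ?addr0 => [|i ib]; last first.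
  rewrite -[X ^+ a0]/(X ^+ (Ordinal a0_a)) phi_ji andbC.
  by move: ib; rewrite -val_eqE /= => /negPf ->; rewrite mulr0 scale0r.
rewrite -[phi _]/(phi (X ^+ (Ordinal a0_a) * Y ^+ (Ordinal i0_b))) phi_ji /=.
by rewrite !eqxx mulr1.
Qed.

(** Contracting with a functional dual to X^a0, where X^a0 Y^B is the term of
    highest degree in Y, removes the factor X^a0 from that term.  The other
    terms have degree in X greater than a0, or do not occur, and land in
    [lower_span B]. *)
Lemma contract_top phi (c : I -> K) m a0 (B i00 : 'I_n) :
    linear (phi : R -> K^o) ->
    i00 = 0%N :> nat ->
    (forall ab : I, phi (monomial ab) = (ab == (a0, i00))%:R) ->
    (forall ab : I, mon_degree ab = m -> c ab != 0 -> (ab.2 <= B)%N) ->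
    mon_degree (a0, B) = m ->
  contract RN phi (\sum_(ab | mon_degree ab == m) c ab *: monomial ab) -
    c (a0, B) *: Y ^+ B \in lower_span B.
Proof.
move=> phi_lin i00E phiE ctop degm.
rewrite (lin_sum (contract_linear RN_pn phi_lin)).
rewrite (bigD1 (a0, B)) /=; last by rewrite degm.
rewrite (linZ (contract_linear RN_pn phi_lin)) (contract_monomial phi_lin phiE) /= i00E.
rewrite binn bin0 mulr1 scale1r subnn mul1r mulr0 addr0 subn0.
rewrite addrAC -scalerBr memvD ?memvZ ?lower_span_shift //.
apply: memv_suml => -[a b] /andP[/eqP/= degab neq].
rewrite (linZ (contract_linear RN_pn phi_lin)).
have [->|cn0] := eqVneq (c (a, b)) 0; first by rewrite scale0r mem0v.
have bB := ctop _ degab cn0; rewrite memvZ // (contract_monomial phi_lin phiE) /= i00E.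
rewrite memvZ // mulr0 addr0 subn0.
have {neq} a0_a : (a0 < a)%N.
  move: neq degab degm bB; rewrite xpair_eqE -!val_eqE /mon_degree /= => neq e1 e2 bB.
  rewrite ltn_neqAle -(leq_add2r B) e2 -e1 leq_add2l bB andbT.
  apply/eqP=> aa; move: neq; rewrite aa eqxx /=; case/eqP.
  by apply/eqP; rewrite -(eqn_add2l a) e1 -aa e2.
suff -> : B = (a - a0 + b)%N :> nat by apply: lower_span_XY; rewrite subn_gt0.
apply/eqP; rewrite -(eqn_add2l a0) addnA (subnKC (ltnW a0_a)).
by move: degab degm; rewrite /mon_degree /= => -> ->.
Qed.

(** Induction on the degree.  If B > 0 is the highest degree in Y of a relation
    and X^a0 Y^B its top term, then a0 < m, so the induction hypothesis provides
    a functional dual to X^a0; contracting the relation gives a multiple of Y^B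
    in [lower_span B], against the minimality of n. *)
Lemma pbw_indep m : indep_in_degree m.
Proof.
have [m' lt_m] := ubnP m; elim: m' m lt_m => // m' IH m; rewrite ltnS => m_le c s0.
move=> ab degab; apply/eqP/negPn/negP=> cab.
pose P ab := (mon_degree ab == m) && (c ab != 0).
have Pab : P ab by rewrite /P degab eqxx.
have [[a0 B] /andP[/eqP degaB caB] top] := @arg_maxnP _ ab P (fun ab => ab.2) Pab.
have ctop (ab' : I) : mon_degree ab' = m -> c ab' != 0 -> (ab'.2 <= B)%N.
  by move=> d' c'; apply: top; rewrite /P d' eqxx.
(* without Y in the top term, the relation reads c X^m = 0 with m < N *)
have [B0|B_gt0] := posnP B.
  have aN := XN_min (ltn_ord a0); case/eqP: aN.
  move: s0; rewrite (bigD1 (a0, B)) /=; last by rewrite degaB.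
  rewrite big1 ?addr0 => [/eqP|[a b] /andP[/eqP dab ne]].
    by rewrite scaler_eq0 (negPf caB) /monomial /= B0 mulr1 => /eqP.
  have [->|cn0] := eqVneq (c (a, b)) 0; first by rewrite scale0r.
  have := ctop _ dab cn0; rewrite /= B0 leqn0 => /eqP b0.
  case/eqP: ne; congr pair; apply: val_inj => /=; last by rewrite B0 b0.
  by move: dab degaB; rewrite /mon_degree /= B0 b0 !addn0 => -> ->.
have a0_m : (a0 < m)%N by rewrite -degaB /mon_degree -{1}[a0 : nat]addn0 ltn_add2l.
have n0 : (0 < n)%N := n_gt0.
have ind : indep_in_degree (mon_degree (a0, Ordinal n0)).
  by apply: IH; rewrite /mon_degree /= addn0; apply: leq_trans m_le.
have [phi [phi_lin phiE]] := dual_functional_in_degree ind.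
have := contract_top phi_lin (i00 := Ordinal n0) erefl phiE ctop degaB.
rewrite s0 (lin0 (contract_linear RN_pn phi_lin)) sub0r memvN rpredZeq.
by rewrite (negPf caB) /= (negPf (Yn_min _)) // B_gt0 ltn_ord.
Qed.

Lemma pbw_free (c : I -> K) :
  \sum_ab c ab *: monomial ab = 0 -> forall ab, c ab = 0.
Proof.
move=> s0 ab; apply: (pbw_indep (m := mon_degree ab)) => //.
exact: homogeneous_part gr_monomial_ab s0.
Qed.

Lemma dual_functional ab0 : exists phi : R -> K, linear (phi : R -> K^o) /\
    forall ab, phi (monomial ab) = (ab == ab0)%:R.
Proof. exact/dual_functional_in_degree/pbw_indep. Qed.

(** The coefficient of X^(N - j) ⊗ X^j in the coproduct of X^N = 0. *)
Lemma bin_X_index_eq0 j : (0 < j < N)%N -> 'C(N, j)%:R = 0 :> K.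
Proof.
move=> /andP[j_gt0 jN].
have [phi [phi_lin phiE]] := dual_functional (Ordinal jN, Ordinal n_gt0).
have := contract_XaYb RN_pn hh XY phi_lin N 0.
rewrite XN mul0r (lin0 (contract_linear RN_pn phi_lin)).
have phiX i : (i < N)%N -> phi (X ^+ i * Y ^+ 0) = (i == j)%:R.
  move=> iN; apply: etrans (phiE (Ordinal iN, Ordinal n_gt0)) _.
  by rewrite xpair_eqE eqxx andbT -val_eqE.
have jN1 : (j < N.+1)%N by apply: ltnW.
rewrite (bigD1 (Ordinal jN1)) //= big_ord1 phiX // eqxx bin0.
rewrite !mulr1 ?subn0 ?expr0 ?mulr1.
rewrite big1 ?addr0 => [|i ij]; last first.
  rewrite big_ord1 /=; have [iN|N_i] := ltnP i N.
    by rewrite phiX // -(inj_eq val_inj) /= in ij *; rewrite (negPf ij) mulr0 scale0r.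
  have -> : i = N :> nat by apply/eqP; rewrite eqn_leq N_i -ltnS ltn_ord.
  by rewrite XN mul0r (lin0 phi_lin) mulr0 scale0r.
move/esym/eqP; rewrite scaler_eq0 => /orP[/eqP //|].
by rewrite (negPf (XN_min _)) // ltn_subrL j_gt0 (ltn_trans j_gt0 jN).
Qed.

Let N_gt0 : (0 < N)%N.
Proof.
by rewrite lt0n; apply/eqP=> N0; move: XN; rewrite N0 => /eqP; rewrite oner_eq0.
Qed.

Lemma Yn_lincomb : exists c : I -> K,
  Y ^+ n = \sum_(ab | mon_degree ab == n) c ab *: monomial ab.
Proof.
have /sum_lineP[c ->] := Yn.
(* terms X^(n - b) Y^b with n - b >= N vanish, the others are basis monomials *)
exists (fun ab => c ab.2).
rewrite -(pair_big_dep xpredT (fun (a : 'I_N) (b : 'I_n) => a + b == n :> nat)%N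
  (fun a b => c b *: (X ^+ a * Y ^+ b))) (exchange_big_dep xpredT) //=.
apply: eq_bigr => b _; have [nbN|N_nb] := ltnP (n - b) N.
  rewrite (big_pred1 (Ordinal nbN)) // => a /=.
  by rewrite -val_eqE /= -[in RHS](eqn_add2r b) subnK // ltnW.
rewrite big_pred0 => [|a].
  by rewrite -(subnK N_nb) exprD XN mulr0 mul0r scaler0.
apply/ltn_eqF; rewrite addnC -ltn_subRL.
exact: leq_trans (ltn_ord a) N_nb.
Qed.

(** The formula of [contract_monomial] extends to Y^n, which is not among the
    basis monomials: the new right factor Y^n is a combination of basis
    monomials of degree n, and phi kills them since it is dual to a monomial of
    another degree. *)
Lemma contract_Yn phi a0 i0 : linear (phi : R -> K^o) ->
    (forall ab : I, phi (monomial ab) = (ab == (a0, i0))%:R) ->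
    mon_degree (a0, i0) != n ->
  contract RN phi (Y ^+ n) = ('C(0, a0)%:R * 'C(n, i0)%:R) *:
    (Y + (a0%:R + h * i0%:R) *: X) ^+ (n - i0).
Proof.
move=> phi_lin phiE deg_n.
have phiYn : phi (Y ^+ n) = 0.
  have [c ->] := Yn_lincomb; rewrite (lin_sum phi_lin) big1 // => ab degab.
  rewrite (linZ phi_lin) phiE; have [e|_] := eqVneq ab (a0, i0); last exact: mulr0.
  by move: degab; rewrite e (negPf deg_n).
have := contract_XaYb RN_pn hh XY phi_lin 0 n; rewrite expr0 mul1r big_ord1 => ->.
have i0n : (i0 < n.+1)%N by apply: ltnW; rewrite ltnS ltn_ord.
have phiY i : (i < n)%N -> phi (Y ^+ i) = ((a0 == 0 :> nat)%N && (i == i0))%:R.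
  move=> i_n; have := phiE (Ordinal N_gt0, Ordinal i_n).
  by rewrite /monomial /= mul1r => ->; rewrite xpair_eqE -!val_eqE /= eq_sym.
rewrite (bigD1 (Ordinal i0n)) //= big1 ?addr0 => [|i ii0]; last first.
  rewrite bin0 expr0 !mul1r.
  move: (ltn_ord i); rewrite ltnS leq_eqVlt => /orP[/eqP->|i_n].
    by rewrite phiYn mulr0 scale0r.
  move: ii0; rewrite -val_eqE /= => /negPf ii0.
  by rewrite phiY // ii0 andbF mulr0 scale0r.
rewrite bin0 expr0 !mul1r phiY // eqxx andbT.
case: posnP => [->|a0_gt0]; first by rewrite bin0 mulr1 mul1r.
by rewrite (bin_small a0_gt0) [false%:R]mulr0n mulr0 mul0r !scale0r.
Qed.

(** Contract the relation for Y^n with a functional dual to Y^i.  The result is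
    binom(n, i) Y^(n - i) modulo smaller monomials, whereas n - i is a positive
    exponent less than n. *)
Lemma bin_Y_index_eq0 i : (0 < i < n)%N -> 'C(n, i)%:R = 0 :> K.
Proof.
move=> /andP[i_gt0 i_n].
have [phi [phi_lin phiE]] := dual_functional (Ordinal N_gt0, Ordinal i_n).
have := contract_Yn phi_lin phiE.
rewrite /mon_degree /= add0n (ltn_eqF i_n) => /(_ isT).
rewrite bin0 mul1r add0r => eYn.
have : contract RN phi (Y ^+ n) \in lower_span (n - i).
  have [c ->] := Yn_lincomb; rewrite (lin_sum (contract_linear RN_pn phi_lin)).
  apply: memv_suml => -[a b] /eqP /= degab.
  rewrite (linZ (contract_linear RN_pn phi_lin)) memvZ //.
  rewrite (contract_monomial phi_lin phiE).
  have [ib|b_i] := leqP i b; last by rewrite /= (bin_small b_i) mulr0 scale0r mem0v.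
  have a_gt0 : (0 < a)%N by rewrite -(ltn_add2r b) add0n [X in (_ < X)%N]degab.
  have := lower_span_XY (0 + h * i%:R) (b - i) a_gt0.
  rewrite addnBA // [(a + b)%N]degab => low.
  by rewrite memvZ //= subn0; exact: low.
rewrite eYn rpredZeq => /orP[/eqP //|low].
have : Y ^+ (n - i) \in lower_span (n - i).
  rewrite -[Y ^+ _](subKr ((Y + (h * i%:R) *: X) ^+ (n - i))).
  by rewrite memvB // lower_span_shift.
by rewrite (negPf (Yn_min _)) // subn_gt0 i_n ltn_subrL i_gt0 n_gt0.
Qed.

(** A monomial X^a0 Y^B with B > 0 of highest degree in Y cannot occur in the
    expression of Y^n: contracting with a functional dual to X^a0 kills Y^n, as
    0 < a0 < n, and isolates Y^B on the other side. *)
Lemma Y_index_power : exists lam, Y ^+ n = lam *: X ^+ n.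
Proof.
(* every term with a nonzero coefficient will turn out to be X^n *)
have [c eYn] := Yn_lincomb; exists (\sum_(ab | mon_degree ab == n) c ab).
rewrite eYn scaler_suml; apply: eq_bigr => -[a' b'] /eqP deg'.
have [->|c'] := eqVneq (c (a', b')) 0; first by rewrite !scale0r.
pose P ab := (mon_degree ab == n) && (c ab != 0).
have Pab : P (a', b') by rewrite /P deg' eqxx.
have [[a0 B] /andP[/eqP degaB caB] top] := @arg_maxnP _ _ P (fun ab => ab.2) Pab.
have ctop (ab : I) : mon_degree ab = n -> c ab != 0 -> (ab.2 <= B)%N.
  by move=> d cab; apply: top; rewrite /P d eqxx.
(* if only powers of X occur, all terms have degree n and are multiples of X^n *)
have [B0|B_gt0] := posnP B.
  have := ctop _ deg' c'; rewrite /= B0 leqn0 => /eqP b0.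
  by move: deg'; rewrite /monomial /mon_degree /= b0 addn0 => ->; rewrite mulr1.
have [phi [phi_lin phiE]] := dual_functional (a0, Ordinal n_gt0).
have a0_n : (a0 < n)%N by rewrite -degaB /mon_degree -{1}[a0 : nat]addn0 ltn_add2l.
have a0_gt0 : (0 < a0)%N.
  by rewrite -(ltn_add2r B) add0n [X in (_ < X)%N]degaB ltn_ord.
have := contract_top phi_lin (i00 := Ordinal n_gt0) erefl phiE ctop degaB.
rewrite -eYn (contract_Yn phi_lin phiE); last by rewrite /mon_degree /= addn0 ltn_eqF.
rewrite bin_small // mul0r scale0r sub0r memvN rpredZeq (negPf caB) /=.
by rewrite (negPf (Yn_min _)) // B_gt0 ltn_ord.
Qed.

End PBW.

(** * Classification *)

Section Binomials.
Variables (K : fieldType) (p : nat) (charKp : p \in [pchar K]).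

Lemma coef_X1n n j : (('X + 1 : {poly K}) ^+ n)`_j = 'C(n, j)%:R.
Proof.
elim: n j => [|n IHn] j; first by rewrite coef1 bin0n eq_sym; case: j.
rewrite exprS mulrDl mul1r coefD coefXM !IHn.
by case: j => [|j] /=; [rewrite add0r !bin0 | rewrite binS natrD addrC].
Qed.

Let Frobenius_poly (u v : {poly K}) e :
  (u + v) ^+ (p ^ e) = u ^+ (p ^ e) + v ^+ (p ^ e).
Proof. exact: (Frobenius_comm charKp _ (mulrC _ _)). Qed.

(** With n = p^e m and m prime to p, the coefficient of X^(p^e) in
    (1 + X)^n = (1 + X^(p^e))^m is m, which is nonzero in K. *)
Lemma ppow_of_bin_eq0 n : (0 < n)%N ->
  (forall j, (0 < j < n)%N -> 'C(n, j)%:R = 0 :> K) -> exists e, n = (p ^ e)%N.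
Proof.
move=> n_gt0 bin0; have p_pr := pcharf_prime charKp.
have [m cop en] := pfactor_coprime p_pr n_gt0; set e := logn p n in en.
exists e; rewrite en; suff -> : m = 1%N by rewrite mul1n.
have q_gt0 : (0 < p ^ e)%N by rewrite expn_gt0 prime_gt0.
have m_gt0 : (0 < m)%N by move: n_gt0; rewrite en muln_gt0 => /andP[].
apply/eqP; rewrite eqn_leq m_gt0 andbT leqNgt; apply/negP=> m_gt1.
have /bin0 : (0 < p ^ e < n)%N by rewrite q_gt0 en ltn_Pmull.
rewrite -coef_X1n en mulnC exprM Frobenius_poly expr1n.
have -> : ('X ^+ (p ^ e) + 1 : {poly K}) = ('X + 1) \Po 'X^(p ^ e).
  by rewrite comp_polyD comp_polyX comp_polyC.
rewrite -rmorphXn /= coef_comp_poly_Xn // dvdnn divnn q_gt0 coef_X1n bin1.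
move/eqP; rewrite -(dvdn_pcharf charKp) => pm.
by move: cop; rewrite prime_coprime // pm.
Qed.

End Binomials.

Section SpanningFamilies.
Variables (K : fieldType) (V : vectType K) (I : finType).

Definition indep_family (F : I -> V) : Prop :=
  forall c : I -> K, \sum_i c i *: F i = 0 -> forall i, c i = 0.

Let family (F : I -> V) := [tuple F (enum_val i) | i < #|I|].

Let family_sum F (c : 'I_#|I| -> K) :
  \sum_i c i *: (family F)`_i = \sum_i c (enum_rank i) *: F i.
Proof.
rewrite (reindex_onto enum_rank enum_val) => [|i _]; last exact: enum_valK.
apply: eq_big => [i|i _]; rewrite ?enum_rankK ?eqxx //.
by rewrite -tnth_nth tnth_mktuple enum_rankK.
Qed.

Let indep_free F : indep_family F <-> free (family F).
Proof.
split=> [indF|/freeP frF c s0 i].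
  apply/freeP=> c; rewrite family_sum => /indF c0 i.
  by rewrite -[i]enum_valK; apply: c0.
rewrite -[i]enum_rankK; apply: (frF (c \o enum_val)).
by rewrite family_sum -[RHS]s0; apply: eq_bigr => j _; rewrite /= enum_rankK.
Qed.

(** Both families have the same index type, hence the same cardinality, which is
    the dimension. *)
Lemma indep_of_spanning (F F' : I -> V) : indep_family F ->
  (forall v, exists c : I -> K, v = \sum_i c i *: F' i) -> indep_family F'.
Proof.
move=> /indep_free/eqP dimF spF'; apply/indep_free.
have full : <<family F'>>%VS = fullv.
  apply/vspaceP=> v; rewrite memvf; have [c ->] := spF' v.
  apply: memv_suml => i _; apply/memvZ/memv_span.
  by rewrite -[i]enum_rankK; apply/mapP; exists (enum_rank i); rewrite ?mem_enum.
rewrite /free eqn_leq dim_span full size_tuple -(size_tuple (family F)) -dimF.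
exact: dimvS (subvf _).
Qed.

End SpanningFamilies.

(** Since the middle binomial coefficients vanish, (Y + a X)^n is
    Y^n + P(a) X^n, where P(a) is the product of the a - h t for t < n.  A root
    of P + lam exists because the field is algebraically closed. *)
Lemma jordan_shift_pow (K : closedFieldType) (A : algType K) (h : K) (X Y : A) n lam :
  jordan_pair h X Y -> (0 < n)%N ->
  (forall j, (0 < j < n)%N -> 'C(n, j)%:R = 0 :> K) ->
  Y ^+ n = lam *: X ^+ n -> exists a, (Y + a *: X) ^+ n = 0.
Proof.
move=> XY n_gt0 binn0 Yn.
pose P := \prod_(t < n) ('X - (h * t%:R)%:P) + lam%:P : {poly K}.
have szP : size P = n.+1.
  have szQ : size (\prod_(t < n) ('X - (h * t%:R)%:P) : {poly K}) = n.+1.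
    rewrite -(big_mkord xpredT (fun t => 'X - (h * t%:R)%:P)) size_prod_XsubC.
    by rewrite size_iota subn0.
  by rewrite size_polyDl szQ // ltnS (leq_trans (size_polyC_leq1 _)).
have /closed_rootP[a ra] : size P != 1 by rewrite szP; case: (n) n_gt0.
exists a; have shift_coefE : shift_coef h a n = - lam.
  apply/eqP; rewrite -addr_eq0; move: ra; rewrite /root /P hornerD hornerC.
  rewrite horner_prod /shift_coef; congr (_ + _ == 0).
  by apply: eq_bigr => t _; rewrite hornerXsubC.
rewrite (jordan_expand XY) big_ord_recr /= binn mul1r subnn expr0 mulr1 shift_coefE.
rewrite (bigD1 (Ordinal n_gt0)) //= big1 ?addr0 => [|j j0].
  by rewrite bin0 /shift_coef big_ord0 !mul1r scale1r subn0 Yn scaleNr subrr.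
by rewrite binn0 ?mul0r ?scale0r // ltn_ord andbT lt0n.
Qed.

Lemma monomial_bases_bijective (K : fieldType) (A : algType K) (B : falgType K)
    (f : {lrmorphism A -> B}) N n (x y : A) (X Y : B) :
  f x = X -> f y = Y ->
  (forall z, exists e : 'I_N * 'I_n -> K,
     z = \sum_ab e ab *: (x ^+ ab.1 * y ^+ ab.2)) ->
  indep_family (fun ab : 'I_N * 'I_n => X ^+ ab.1 * Y ^+ ab.2) ->
  (forall z, exists e : 'I_N * 'I_n -> K,
     z = \sum_ab e ab *: (X ^+ ab.1 * Y ^+ ab.2)) ->
  bijective f.
Proof.
move=> fx fy spanA freeB spanB.
have f_mon (e : 'I_N * 'I_n -> K) :
    f (\sum_ab e ab *: (x ^+ ab.1 * y ^+ ab.2)) =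
    \sum_ab e ab *: (X ^+ ab.1 * Y ^+ ab.2).
  rewrite linear_sum; apply: eq_bigr => ab _.
  by rewrite linearZ /= rmorphM !rmorphXn /= fx fy.
have f_inj : injective f.
  move=> u v fuv; have : f (u - v) = 0 by rewrite rmorphB /= fuv subrr.
  have [e uv] := spanA (u - v); rewrite uv f_mon => /freeB e0.
  by apply/eqP; rewrite -subr_eq0 uv big1 // => ab _; rewrite e0 scale0r.
have f_surj r : exists u, f u = r.
  by have [e ->] := spanB r; eexists; apply: f_mon.
pose f' r := projT1 (cid (f_surj r)).
have f'K : cancel f' f by move=> r; rewrite /f'; case: cid.
by exists f' => // u; apply: f_inj; rewrite f'K.
Qed.

Lemma G_iso_unique (K : closedFieldType) (p : nat) (charKp : p \in [pchar K])
    (p_gt2 : (2 < p)%N) (R : algType K) (H : braidedHopf R) k l k' l' :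
  (0 < k)%N -> (0 < k')%N ->
  braided_hopf_iso H (G_pn charKp k l) -> braided_hopf_iso H (G_pn charKp k' l') ->
  (k, l) = (k', l').
Proof.
move=> k0 k'0 iso iso'.
have le k1 l1 k2 l2 : (0 < k1)%N -> (0 < k2)%N ->
    braided_hopf_iso H (G_pn charKp k1 l1) ->
    braided_hopf_iso H (G_pn charKp k2 l2) -> (k2 <= k1)%N && (l2 <= l1)%N.
  move=> k10 k20 [f fm fb] [g gm [g' gK g'K]].
  have [f' _ [f'' f'K f''K]] := braided_hopf_iso_inv fm fb.
  pose t : {lrmorphism G charKp k1 l1 -> G charKp k2 l2} := g \o f'.
  have t_surj z : exists u, t u = z.
    by exists (f'' (g' z)); rewrite /t /= f''K g'K.
  by rewrite (G_surjection_k p_gt2 t_surj k10) (G_surjection_l p_gt2 t_surj k20).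
have /andP[le1 le2] := le _ _ _ _ k0 k'0 iso iso'.
have /andP[le3 le4] := le _ _ _ _ k'0 k0 iso' iso.
by congr pair; apply/eqP; rewrite eqn_leq ?le1 ?le2 ?le3 ?le4.
Qed.

Theorem theorem3p6 (K : closedFieldType) (p : nat)
    (charKp : p \in [pchar K]) (p_gt2 : (2 < p)%N)
    (R : falgType K) (RN : preNichols (Vsp K) R)
    (RN_pre_nichols : is_pre_nichols (@cV K) RN)
    (f : {lrmorphism jordan K -> R})
    (f_morphism : is_pre_nichols_morphism (jordan_pn K) RN f)
    (f_surj : forall r : R, exists b : jordan K, f b = r) :
  exists! kl : nat * nat,
    [/\ (0 < kl.1)%N, (0 < kl.2)%N
      & braided_hopf_iso RN (G_pn charKp kl.1 kl.2)].
Proof.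
pose h := 2%:R^-1 : K.
have hh : h + h = 1 by rewrite -mulr2n -mulr_natr mulVf // (two_neq0 charKp p_gt2).
pose X := pn_inj RN (xV K); pose Y := pn_inj RN (yV K).
have [_ _ f_inj] := f_morphism.
have fX : f (jx K) = X := f_inj (xV K).
have fY : f (jy K) = Y := f_inj (yV K).
have XY : jordan_pair h X Y.
  exact: jordan_pair_rmorph fX fY (jordan_pair_jordan K).
have inj_lin := pn_inj_linear RN_pre_nichols.
have inj_inj := pn_inj_injective RN_pre_nichols.
have exN : exists m, X ^+ m == 0.
  by have [m _ Xm] := gr1_nilpotent RN_pre_nichols (xV K); exists m; apply/eqP.
case: (ex_minnP exN) => N /eqP XN N_min {exN}.
have XN_min a : (a < N)%N -> X ^+ a != 0.
  by move=> aN; apply: contraL aN => /N_min; rewrite leqNgt.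
have exn : exists m, (0 < m)%N && (Y ^+ m \in lower_span RN m).
  have [m m0 Ym] := gr1_nilpotent RN_pre_nichols (yV K).
  by exists m; rewrite m0 /Y Ym mem0v.
case: (ex_minnP exn) => n /andP[n_gt0 Yn] n_min {exn}.
have Yn_min b : (0 < b < n)%N -> Y ^+ b \notin lower_span RN b.
  move=> /andP[b0 bn]; apply: contraL bn => Yb.
  by rewrite -leqNgt; apply: n_min; rewrite b0.
have n_bin := bin_Y_index_eq0 RN_pre_nichols hh XY XN XN_min n_gt0 Yn Yn_min.
have N_bin := bin_X_index_eq0 RN_pre_nichols hh XY XN XN_min n_gt0 Yn_min.
have [lam Yn_lam] := Y_index_power RN_pre_nichols hh XY XN XN_min n_gt0 Yn Yn_min.
have mon_free := pbw_free RN_pre_nichols hh XY XN_min n_gt0 Yn_min.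
have [a Y'n] := jordan_shift_pow XY n_gt0 n_bin Yn_lam.
have N_gt0 : (0 < N)%N.
  by rewrite lt0n; apply/eqP=> N0; move: XN; rewrite N0 => /eqP; rewrite oner_eq0.
have [k nE] := ppow_of_bin_eq0 charKp n_gt0 n_bin.
have [l NE] := ppow_of_bin_eq0 charKp N_gt0 N_bin.
(* k = 0 or l = 0 would make y proportional to x, or x zero, already in V *)
have k_gt0 : (0 < k)%N.
  rewrite lt0n; apply/eqP=> k0; move: Yn_lam; rewrite nE k0 !expr1.
  rewrite -(linZ inj_lin) => /inj_inj/matrixP/(_ ord0 ord_max)/eqP.
  by rewrite !mxE /= mulr0 oner_eq0.
have l_gt0 : (0 < l)%N.
  rewrite lt0n; apply/eqP=> l0; move: XN; rewrite NE l0 expr1.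
  rewrite -(lin0 inj_lin) => /inj_inj/matrixP/(_ ord0 ord0)/eqP.
  by rewrite !mxE /= oner_eq0.
have XY' := jordan_shift XY a; set Y' := Y + a *: X in Y'n XY'.
have genR r : subalg (fun z => z = X \/ z = Y') r.
  have [b <-] := f_surj r; apply: subalg_im (jordan_gen b) => _ [] ->.
    by rewrite [f _]fX; apply: subalg_mem; left.
  rewrite [f _]fY -[Y](addrK (a *: X)) -scaleNr; apply: subalgD.
    by apply: subalg_mem; right.
  by apply/subalgZ/subalg_mem; left.
have spanR := jordan_span XY' genR n_gt0 XN Y'n.
have freeR := indep_of_spanning mon_free spanR.
rewrite NE in XN; rewrite nE in Y'n.
have [g gX gY] := G_lift charKp XY' XN Y'n.
have g_morphism := G_morphism RN_pre_nichols gX gY.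
have gxN : gx charKp k l ^+ N = 0 by rewrite NE gx_pow.
have gyn : gy charKp k l ^+ n = 0 by rewrite nE gy_pow.
have spanG := jordan_span (jordan_pair_G charKp k l) (G_gen (l := l)) n_gt0 gxN gyn.
have g_bij := monomial_bases_bijective gX gY spanG freeR spanR.
have iso := braided_hopf_iso_inv g_morphism g_bij.
exists (k, l); split=> [|[k' l'] [/= k'0 l'0 iso']]; first by split.
exact (G_iso_unique p_gt2 k_gt0 k'0 iso iso').
Qed.
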